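(* Let $n\ge 0$ and $p\ge 1$ be integers. Let $\mathcal F_{n,p}^{\mathrm{ci}}$ be the set of forests with $p$ trees and $n$ edges carrying a distinguished corner together with an integer in $\{1,\dots,p+1\}$, let $\mathcal F_{n,p+1}^{\mathrm{vi}}$ be the set of forests with $p+1$ trees and $n$ edges carrying a distinguished vertex together with an integer in $\{1,\dots,p\}$, and let $\Psi_{n,p\uparrow}$ and $\Psi_{n,p+1\downarrow}$ be the explicit cut-and-glue mappings defined in the context. Then the mappings $$\Psi_{n,p\uparrow}:\mathcal F_{n,p}^{\mathrm{ci}}\to\mathcal F_{n,p+1}^{\mathrm{vi}}\qquad\text{and}\qquad \Psi_{n,p+1\downarrow}:\mathcal F_{n,p+1}^{\mathrm{vi}}\to\mathcal F_{n,p}^{\mathrm{ci}}$$ are one-to-one and reverse one from another (that is, they are bijections inverse to each other).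
   Context: **Maps.** A planar map is an embedding of a finite connected graph (loops and multiple edges allowed) in the oriented two-dimensional sphere, up to direct homeomorphisms. Faces are the connected components of the complement of the edges. A half-edge is an edge with one of its two orientations; for a half-edge $h$, $h^-$ is its origin, $h^+$ its end, $\mathrm{rev}(h)$ its reverse. A half-edge is incident to a face if it belongs to the boundary of the face and the face lies to its left. A corner of a face is an angular sector delimited by two consecutive half-edges $h,h'$ incident to the face (the map reduced to one vertex has one corner). A corner $c$ is also viewed as a half-edge with no origin, only an end $c^+:=h^+=h'^-$ (a dangling half-edge lying in the face and pointing at the vertex). Maps are rooted: one corner is distinguished. **Forests.** A tree is a rooted planar map with one face (the tree with one vertex and no edge is allowed). A forest with $p$ trees and $n$ edges is a $p$-tuple $\mathfrak f=(\mathfrak t_1,\dots,\mathfrak t_p)$ of trees with $n$ edges in total; $\mathcal F_{n,p}$ is the set of these. Let $\rho_i$ be the root vertex of $\mathfrak t_i$ and $\rho_{p+1}:=\rho_1$. For $1\le i\le p$ one adds an extra half-edge from $\rho_i$ to $\rho_{i+1}$, arriving and leaving in the root corners of the trees, so that the forest becomes a map with two faces: an inner face of degree $p$, bounded by the simple cycle formed by the extra half-edges and lying to their right, and an outer face containing the trees and lying to the left of the extra half-edges. Extra half-edges may be used by paths only in the direction $\rho_i\to\rho_{i+1}$; they do not count as edges of the forest. The corners of the forest are the corners of the outer face; there are $2n+p$ of them, and the forest has $n+p$ vertices. The contour is the cyclic sequence of half-edges incident to the outer face (travelled with the outer face to the left), starting with tree $\mathfrak t_1$, then $\mathfrak t_2$,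 etc.; it orders the corners (cyclically). The last corner of the $i$-th tree is the corner at $\rho_i$ just before the extra half-edge leaving $\rho_i$. Re-rooting a forest means cyclically shifting the indices of its trees. **Distinguishing twice.** Distinguishing a corner splits it into two new corners; so when the same corner is distinguished a second time, one specifies on which of its two sides it is distinguished. **Paths.** A path from $v$ to $v'$ is a finite sequence $\mathbf p=(\mathbf p_1,\dots,\mathbf p_\ell)$ of half-edges with $\mathbf p_1^-=v$, $\mathbf p_k^+=\mathbf p_{k+1}^-$, $\mathbf p_\ell^+=v'$; its length is $[\mathbf p]=\ell$; the empty path has length $0$. It is self-avoiding if it visits no vertex twice. $\mathrm{rev}(\mathbf p)=(\mathrm{rev}(\mathbf p_\ell),\dots,\mathrm{rev}(\mathbf p_1))$ and $\bullet$ denotes concatenation. **Cutting and gluing.** Given two distinguished corners $a,b$ of the outer face and a self-avoiding path $\mathbf q$ from $a^+$ to $b^+$, cutting along $\mathbf q$ between $a$ and $b$ produces two maps: the left part, made of all the elements encountered between $a$ and $b$ in the (cyclic) contour together with a copy of $\mathbf q$, and the right part, made of all the elements encountered between $b$ and $a$ in the (cyclic) contour together with a copy of $\mathbf q$. (Topologically, these are what lies to the left, resp. to the right, of the curve entering through $a$, following $\mathbf q$, and leaving through $b$; the inner face lies in exactly one part.) Matching a half-edge of the left part with a half-edge of the right part means identifying them, origin with origin and end with end, so that the left part lies to the left and the right part to the right of the resulting path. **Definition of $\Psi_{n,p\uparrow}$.** Let $(\mathfrak f;c,i)\in\mathcal F_{n,p}^{\mathrm{ci}}$. Let $j\in\{1,\dots,p\}$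 be the index of the tree of $\mathfrak f$ to which $c^+$ belongs and let $c'$ be the last corner of this tree (located after $c$ if $c$ is itself in the last corner). Let $\mathbf p$ be the only self-avoiding path from $c^+$ to $c'^+$ and cut along $\mathbf p$ between $c$ and $c'$. In the left part, consider $c$ as an extra half-edge (with a new vertex as origin) and set $\mathbf l:=c\bullet\mathbf p$. In the right part, add an extra tree consisting of one vertex between the $j$-th and the $(j+1)$-th tree of $\mathfrak f$ (cyclically), denote by $h$ the extra half-edge linking the root of the $j$-th tree to this extra tree, and set $\mathbf r:=\mathbf p\bullet h$. Glue back together both parts while matching $\mathbf l_k$ with $\mathbf r_k$ for $1\le k\le[\mathbf l]=[\mathbf r]$, and let $v:=\mathbf l_1^-$. Finally, $\mathfrak f'$ is obtained by re-rooting the resulting forest (which has $p+1$ trees) in such a way that $v$ belongs to the $i$-th tree. Set $\Psi_{n,p\uparrow}(\mathfrak f;c,i):=(\mathfrak f';v,j)$. **Definition of $\Psi_{n,p+1\downarrow}$.** Let $(\mathfrak f';v,j)\in\mathcal F_{n,p+1}^{\mathrm{vi}}$. Let $i$ be the index of the tree to which $v$ belongs and let $\mathbf p$ be the self-avoiding path from $v$ to the root of the $(i+1)$-th tree (the $(i+1)$-th tree being the first tree if $i=p+1$). Cut along $\mathbf p$ between the corner delimited by $\mathbf p_1$ and its predecessor in the contour, and the last corner of the $(i+1)$-th tree. Let $\mathbf l$ and $\mathbf r$ be the images of $\mathbf p$ in the left part and the right part. Glue the parts back while matching $\mathbf l_{k+1}$ with $\mathbf r_k$ for $1\le k\le[\mathbf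 l]-1$ (if $[\mathbf l]=1$, one only identifies the vertices $\mathbf l_1^+$ and $\mathbf r_1^-$). The dangling half-edge $\mathbf l_1$, which is not glued with anything, is replaced by the corner $c$ it defines. The $(i+1)$-th tree of this new forest consists of only one vertex; it is removed (the extra half-edges entering and leaving it being replaced by a single one). Finally, $\mathfrak f$ is obtained by re-rooting the latter forest in such a way that $c^+$ belongs to the $j$-th tree. Set $\Psi_{n,p+1\downarrow}(\mathfrak f';v,j):=(\mathfrak f;c,i)$. *)

(* Defs.v *)
From HB Require Import structures.
From mathcomp Require Import all_boot.

Set Implicit Arguments.
Unset Strict Implicit.
Unset Printing Implicit Defensive.

(* A rooted planar map with one face is the same thing as a plane tree; the
   subtrees hanging from a vertex are listed in the order in which the contour,
   started from the root corner, meets them. *)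
Inductive tree : Type := Node of seq tree.

Fixpoint tree_edges (t : tree) : nat :=
  let: Node ts := t in sumn [seq (tree_edges t').+1 | t' <- ts].

(* A vertex of a tree is designated by its address, the empty address being the
   root and [rcons w k] the root of the k-th subtree at the vertex [w]. *)
Fixpoint tree_vertex (t : tree) (w : seq nat) : bool :=
  if w is k :: w' then
    let: Node ts := t in (k < size ts) && tree_vertex (nth (Node [::]) ts k) w'
  else true.

(* Trees are numbered from 0: the indices 1, ..., p become 0, ..., p - 1. *)
Record forest (n p : nat) := Forest {
  trees :> p.-tuple tree;
  _ : sumn [seq tree_edges t | t <- trees] == n }.

Definition next_tree (p i : nat) : nat := i.+1 %% p.

Definition vertex : Type := (nat * seq nat)%type.

Definition is_vertex (f : seq tree) (v : vertex) : bool :=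
  (v.1 < size f) && tree_vertex (nth (Node [::]) f v.1) v.2.

Definition tree_root (i : nat) : vertex := (i, [::]).

(* [Edge i w b] is the half-edge between the vertex [w <> [::]] of the i-th tree
   and its parent, directed towards the parent iff [b = true].
   [Extra i true] is the extra half-edge from the i-th root to the next one, and
   [Extra i false] its reverse, which is incident to the inner face. *)
Inductive dart : Type :=
  | Edge of nat & seq nat & bool
  | Extra of nat & bool.

Definition dart_code (d : dart) : nat * seq nat * bool + nat * bool :=
  match d with Edge i w b => inl (i, w, b) | Extra i b => inr (i, b) end.
Definition dart_decode (x : nat * seq nat * bool + nat * bool) : dart :=
  match x with inl (i, w, b) => Edge i w b | inr (i, b) => Extra i b end.
Lemma dart_codeK : cancel dart_code dart_decode.
Proof. by case. Qed.
HB.instance Definition _ := Equality.copy dart (can_type dart_codeK).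

Definition flip (d : dart) : dart :=
  match d with
  | Edge i w b => Edge i w (~~ b)
  | Extra i b => Extra i (~~ b)
  end.

Definition parent (w : seq nat) : seq nat := take (size w).-1 w.

Definition org (p : nat) (d : dart) : vertex :=
  match d with
  | Edge i w b => (i, if b then w else parent w)
  | Extra i b => tree_root (if b then i else next_tree p i)
  end.

Definition tgt (p : nat) (d : dart) : vertex := org p (flip d).

Fixpoint tree_contour (i : nat) (w : seq nat) (t : tree) : seq dart :=
  let: Node ts := t in
  (fix children (k : nat) (us : seq tree) : seq dart :=
     if us is u :: us' then
       Edge i (rcons w k) false :: tree_contour i (rcons w k) u
         ++ Edge i (rcons w k) true :: children k.+1 us'
     else [::]) 0 ts.

(* The half-edges incident to the outer face, in contour order.  The corner that
   lies just before the half-edge [d] of the contour, at the vertex [org p d], is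
   represented by [d]; in particular [Extra i true] represents the last corner of
   the i-th tree. *)
Definition contour (f : seq tree) : seq dart :=
  flatten [seq rcons (tree_contour i [::] (nth (Node [::]) f i)) (Extra i true)
          | i <- iota 0 (size f)].

(* Maps are given by the cycles of half-edges incident to their faces (each
   half-edge being incident to one face, which lies to its left) and the reversal
   of half-edges.  Vertices are implicit: the half-edges leaving a vertex are an
   orbit of [d |-> successor of rev_of M d in its face]. *)
Record cmap (D : eqType) := CMap {
  faces : seq (seq D);
  rev_of : D -> D }.

Definition darts (D : eqType) (M : cmap D) : seq D := flatten (faces M).

(* Isomorphism of maps with labelled faces. *)
Definition map_iso (D E : eqType) (M : cmap D) (N : cmap E) (phi : D -> E) : Prop :=
  [/\ size (faces M) = size (faces N),
      forall k, exists m,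
        nth [::] (faces N) k = rot m [seq phi d | d <- nth [::] (faces M) k],
      {in darts M &, injective phi} &
      {in darts M, forall d, phi (rev_of M d) = rev_of N (phi d)}].

(* The outer face comes first.  No index of tree is distinguished: up to
   isomorphism, the map does not see re-rootings of the forest. *)
Definition forest_map (f : seq tree) : cmap dart :=
  CMap [:: contour f; [seq Extra i false | i <- rev (iota 0 (size f))]] flip.

(* The half-edges [Extra i false], not being in the contour, cannot be used. *)
Fixpoint is_path (f : seq tree) (v : vertex) (q : seq dart) (v' : vertex) : bool :=
  if q is d :: q' then
    [&& d \in contour f, org (size f) d == v & is_path f (tgt (size f) d) q' v']
  else v == v'.

Definition self_avoiding (f : seq tree) (v : vertex) (q : seq dart) (v' : vertex) :
    bool :=
  is_path f v q v' && uniq (v :: [seq tgt (size f) d | d <- q]).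

Definition rev_path (D : eqType) (r : D -> D) (q : seq D) : seq D := rev [seq r d | d <- q].

(* Half-edges of the maps obtained by surgery: [Old d] is an original half-edge
   and [Copy d] the duplicate created by cutting along the edge of [d]; [Stub]
   and [Link] are the two half-edges of two possible additional edges. *)
Inductive label (D : Type) : Type :=
  | Old of D
  | Copy of D
  | Stub of bool
  | Link of bool.
Arguments Stub {D}.
Arguments Link {D}.

Definition label_code (D : Type) (x : label D) : D + D + (bool + bool) :=
  match x with
  | Old d => inl (inl d) | Copy d => inl (inr d)
  | Stub b => inr (inl b) | Link b => inr (inr b)
  end.
Definition label_decode (D : Type) (x : D + D + (bool + bool)) : label D :=
  match x with
  | inl (inl d) => Old d | inl (inr d) => Copy d
  | inr (inl b) => Stub b | inr (inr b) => Link b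
  end.
Lemma label_codeK (D : Type) : cancel (@label_code D) (@label_decode D).
Proof. by case. Qed.
HB.instance Definition _ (D : eqType) :=
  Equality.copy (label D) (can_type (@label_codeK D)).

(* A map cut (along a path) into a left part and a right part.  The boundary of
   the left part is [lside ++ rev_path lpath], that of the right part is
   [rside ++ rpath]: [lside] and [rside] are the pieces of contour, and [lpath],
   [rpath] the two copies of the path.  [others] are the faces that have not been
   cut. *)
Record cut_map (D : eqType) := CutMap {
  lside : seq D;
  lpath : seq D;
  rside : seq D;
  rpath : seq D;
  others : seq (seq D);
  cut_rev : D -> D }.

Section CutAndGlue.
Variable D : eqType.

(* After the cut, the half-edge [d] of the path bounds the left part and is there
   the reverse of [Copy (rev d)], whereas [rev d] stays in the right part and is
   there the reverse of [Copy d]. *)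
Definition cut_reversal (r : D -> D) (q : seq D) (x : label D) : label D :=
  match x with
  | Old d => if (d \in q) || (r d \in q) then Copy (r d) else Old (r d)
  | Copy d => Old (r d)
  | Stub b => Stub (~~ b)
  | Link b => Link (~~ b)
  end.

(* Cutting along [q] between the corners [a] and [b] of the first face (each given
   by the half-edge of the face that follows it).  When both corners are the same,
   [b] is taken to be located just after [a]. *)
Definition cut (M : cmap D) (a b : D) (q : seq D) : cut_map (label D) :=
  let s := head [::] (faces M) in
  let s_a := rot (index a s) s in
  let k := index b s_a in
  CutMap [seq Old d | d <- take k s_a] [seq Old d | d <- q]
         [seq Old d | d <- drop k s_a] [seq Copy d | d <- q]
         [seq [seq Old d | d <- g] | g <- behead (faces M)]
         (cut_reversal (rev_of M) q).

(* Identifying the k-th terms of [lm] and [rm]: the resulting edge has the side of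
   [lm] on its left and the side of [rm] on its right, so that the half-edges of
   [rm], and the reverses of those of [lm], disappear. *)
Definition glue_reversal (r : D -> D) (lm rm : seq D) (d : D) : D :=
  if d \in lm then r (nth d rm (index d lm))
  else if r d \in rm then nth d lm (index (r d) rm)
  else r d.

(* Gluing back while matching the (s + k)-th half-edge of [lpath] with the k-th one
   of [rpath], for all k such that s + k <= size (lpath S). *)
Definition glue (s : nat) (S : cut_map D) : cmap D :=
  let lm := drop s (lpath S) in
  let rm := take (size lm) (rpath S) in
  CMap ((lside S ++ drop (size lm) (rpath S)
           ++ rside S ++ rev_path (cut_rev S) (take s (lpath S))) :: others S)
       (glue_reversal (cut_rev S) lm rm).

Definition delete_edges (ds : seq D) (M : cmap D) : cmap D :=
  let del := [pred d | (d \in ds) || (rev_of M d \in ds)] in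
  CMap [seq [seq d <- g | ~~ del d] | g <- faces M] (rev_of M).

End CutAndGlue.

(* The corner [c] is turned into the half-edge [Stub true], with a new origin. *)
Definition add_stub (S : cut_map (label dart)) : cut_map (label dart) :=
  CutMap (Stub true :: lside S) (Stub true :: lpath S)
         (rside S) (rpath S) (others S) (cut_rev S).

(* The extra half-edge leaving the j-th root is subdivided by a new root:
   [Link true] goes from the j-th root to the new root and [Old (Extra j true)]
   from the new root to the former end.  [Link true], which now ends the
   right copy of the path, is part of the boundary of the right part. *)
Definition add_tree (j : nat) (S : cut_map (label dart)) : cut_map (label dart) :=
  CutMap (lside S) (lpath S)
         (rside S) (rcons (rpath S) (Link true))
         [seq flatten [seq if d == Old (Extra j false) then [:: d; Link false]
                           else [:: d] | d <- g] | g <- others S]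
         (cut_rev S).

Definition map_up (f : seq tree) (c : dart) (j : nat) (q : seq dart) :
    cmap (label dart) :=
  glue 0 (add_tree j (add_stub (cut (forest_map f) c (Extra j true) q))).

(* The path is [h :: q].  The dangling edge of [h] is deleted, and so is the
   one-vertex tree, by deleting the extra edge that enters it: the one that
   leaves it then takes over. *)
Definition map_down (f : seq tree) (i : nat) (h : dart) (q : seq dart) :
    cmap (label dart) :=
  delete_edges [:: Old h; Copy (last h q)]
    (glue 1 (cut (forest_map f) h (Extra (next_tree (size f) i) true) (h :: q))).

(* After the deletions, the half-edge of the contour that comes first is the one
   that followed the dangling half-edge [Old h]; the corner defined by the latter
   lies just before it. *)
Definition corner_down (f : seq tree) (i : nat) (h : dart) (q : seq dart) : label dart :=
  head (Old h) (head [::] (faces (map_down f i h q))).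

Record forest_ci (n p : nat) := ForestCI {
  ci_forest :> forest n p;
  ci_corner : dart;
  ci_index : 'I_p.+1;
  _ : ci_corner \in contour ci_forest }.

(* Beware that [forest_vi n p] is made of forests with p + 1 trees. *)
Record forest_vi (n p : nat) := ForestVI {
  vi_forest :> forest n p.+1;
  vi_vertex : vertex;
  vi_index : 'I_p;
  _ : is_vertex vi_forest vi_vertex }.

(* [psi_up x y]: y is obtained from x by the cut-and-glue procedure. *)
Definition psi_up (n p : nat) (x : forest_ci n p) (y : forest_vi n p) : Prop :=
  let f := ci_forest x in
  let c := ci_corner x in
  let j := (org p c).1 in
  exists (q : seq dart) (phi : label dart -> dart),
    [/\ self_avoiding f (org p c) q (tree_root j),
        map_iso (map_up f c j q) (forest_map (vi_forest y)) phi,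
        org p.+1 (phi (Stub true)) = vi_vertex y,
        (vi_vertex y).1 = ci_index x &
        vi_index y = j :> nat].

Definition psi_down (n p : nat) (y : forest_vi n p) (x : forest_ci n p) : Prop :=
  let f := vi_forest y in
  let v := vi_vertex y in
  let i := v.1 in
  exists (h : dart) (q : seq dart) (phi : label dart -> dart),
    [/\ self_avoiding f v (h :: q) (tree_root (next_tree p.+1 i)),
        map_iso (map_down f i h q) (forest_map (ci_forest x)) phi,
        phi (corner_down f i h q) = ci_corner x,
        (org p (ci_corner x)).1 = vi_index y &
        ci_index x = i :> nat].

(* Main.v *)
Require Import Defs.
From mathcomp Require Import all_boot zify.

(** The contour of a forest is a cyclic word with three kinds of letters: an edge is
    descended, an edge is climbed back, an extra half-edge leads to the next tree.  Call
    closing letters those of the last two kinds: each of them ends the visit of one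
    vertex, so that they correspond to the vertices, whereas the corners correspond to
    the gaps between consecutive letters.  A forest with [p] trees and [n] edges, up to
    re-rooting, is the same thing as a cyclic word with [n] descending and [n + p]
    closing letters, the matching of descents and closing letters being that of
    parentheses.

    In these terms the upward mapping inserts a closing letter at the distinguished
    corner, and the downward mapping removes the closing letter of the distinguished
    vertex.  After the insertion, each descent of the branch leading to the corner is
    matched with the climbing letter that comes one step earlier on the way to the root,
    the first one with the new letter, and the last climbing letter becomes an extra
    half-edge: this is the shift by one step that is made when gluing.  The indices
    [i] and [j] record where the two forests are rooted.

    On trees, the insertion is the relation [graft]; the corresponding operation on
    words, with arbitrary letters, is [splice].  A map represents a forest
    ([represents]) when its outer face is a contour word of the forest and its inner
    face is made of the reverses of the extra letters.  The lemmas [map_up_represents]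
    and [map_down_represents] show that the maps obtained by surgery represent the
    grafted forests.  Existence of the isomorphisms follows as two maps representing the
    same forest are isomorphic ([represents_iso]); uniqueness follows as the map of a
    forest only represents the re-rootings of this forest ([represents_rigid]), the
    index of the distinguished tree then fixing the re-rooting.  Both mappings thus
    realise the relation [grafted] and its converse. *)

Set Implicit Arguments.
Unset Strict Implicit.
Unset Printing Implicit Defensive.

(** * Subforests and their contours *)

(** The list of the subtrees hanging from the root. *)
Definition children (t : tree) : seq tree := let: Node ts := t in ts.

(** Induction on plane forests, seen as binary trees: a nonempty forest is given by the
    subtrees of its first root and by the other trees. *)
Lemma forest_ind (P : seq tree -> Prop) :
  P [::] -> (forall ts us, P ts -> P us -> P (Node ts :: us)) -> forall us, P us.
Proof.
move=> P0 PS; pose F := fix F (t : tree) : P (children t) :=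
  let: Node ts := t return P (children t) in
  (fix G (us : seq tree) : P us :=
     if us is u :: us' then
       (let: Node vs as v := u return P (children v) -> P (v :: us') in
        fun Pvs => PS vs us' Pvs (G us')) (F u)
     else P0) ts.
by move=> us; exact: (F (Node us)).
Qed.

(** The part of the contour of the [i]-th tree that visits the subtrees [us] hanging
    from the vertex [w], which are the children number [k], [k + 1], ... of [w]. *)
Fixpoint kids (i : nat) (w : seq nat) (k : nat) (us : seq tree) : seq dart :=
  if us is u :: us' then
    Edge i (rcons w k) false :: tree_contour i (rcons w k) u
      ++ Edge i (rcons w k) true :: kids i w k.+1 us'
  else [::].

Lemma tree_contourE i w t : tree_contour i w t = kids i w 0 (children t).
Proof.
case: t => ts /=.
by elim: ts 0 => //= u us IH k; rewrite IH.
Qed.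

Lemma kids_cons i w k ts us :
  kids i w k (Node ts :: us) =
  Edge i (rcons w k) false :: kids i (rcons w k) 0 ts
    ++ Edge i (rcons w k) true :: kids i w k.+1 us.
Proof.
by rewrite -[kids _ (rcons _ _) _ _]/(kids i (rcons w k) 0 (children (Node ts)))
  -tree_contourE.
Qed.

Lemma kids_cat i w k us vs :
  kids i w k (us ++ vs) = kids i w k us ++ kids i w (k + size us) vs.
Proof.
elim: us k => [|u us IH] k; first by rewrite addn0.
by rewrite /= IH addSnnS -catA.
Qed.

(** * Contour words of abstract forests *)

(** [codes r ts s]: the word [s] goes around the plane forest [ts], its letters being
    arbitrary labels.  Each edge contributes a letter [d] when it is descended and
    the letter [r d] when it is climbed back, and [r] exchanges both. *)
Inductive codes (D : Type) (r : D -> D) : seq tree -> seq D -> Prop :=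
| codes_nil : codes r [::] [::]
| codes_cons ts us d s t : codes r ts s -> codes r us t -> r (r d) = d ->
    codes r (Node ts :: us) (d :: s ++ r d :: t).

Lemma codes_nilI (D : Type) (r : D -> D) s : codes r [::] s -> s = [::].
Proof. by move=> cs; inversion cs. Qed.

Lemma codes_consI (D : Type) (r : D -> D) ts us s : codes r (Node ts :: us) s ->
  exists d s1 s2,
    [/\ codes r ts s1, codes r us s2, r (r d) = d & s = d :: s1 ++ r d :: s2].
Proof.
move=> cs; inversion cs as [|ts' us' d s1 s2 c1 c2 rd e1 e2]; subst.
by exists d, s1, s2.
Qed.

Lemma codes_cat (D : Type) (r : D -> D) ts us s t :
  codes r ts s -> codes r us t -> codes r (ts ++ us) (s ++ t).
Proof.
move=> cs ct; elim: cs => //= ts1 us1 d s1 t1 c1 _ _ IH rd.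
by rewrite -catA; apply: codes_cons.
Qed.

Lemma codes_size (D E : Type) (r : D -> D) (r' : E -> E) ts s t :
  codes r ts s -> codes r' ts t -> size s = size t.
Proof.
move=> cs; elim: cs t => [|ts1 us1 d s1 t1 _ IH1 _ IH2 _] t.
  by move=> /codes_nilI ->.
move=> /codes_consI[d' [s2 [t2 [/IH1 e1 /IH2 e2 _ ->]]]] /=.
by rewrite !size_cat /= e1 e2.
Qed.

Lemma eq_codes (D : eqType) (r r' : D -> D) ts s :
  {in s, r =1 r'} -> codes r ts s -> codes r' ts s.
Proof.
move=> + cs; elim: cs => [|ts1 us1 d s1 t1 _ IH1 _ IH2 rd] rr'.
  exact: codes_nil.
have Hd : r d = r' d by apply: rr'; rewrite inE eqxx.
have Hrd : r (r d) = r' (r d).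
  by apply: rr'; rewrite inE mem_cat inE eqxx !orbT.
rewrite Hd; apply: codes_cons.
- by apply: IH1 => x xs; apply: rr'; rewrite inE mem_cat xs orbT.
- by apply: IH2 => x xs; apply: rr'; rewrite inE mem_cat inE xs !orbT.
- by rewrite -Hd -Hrd.
Qed.

Lemma codes_closed (D : eqType) (r : D -> D) ts s :
  codes r ts s -> {in s, forall d, r d \in s /\ r (r d) = d}.
Proof.
move=> cs; elim: cs => // ts1 us1 d s1 t1 _ IH1 _ IH2 rd x.
rewrite !inE mem_cat inE => /orP[/eqP->|/orP[/IH1|/orP[/eqP->|/IH2]]].
- by rewrite mem_cat inE eqxx !orbT.
- by case=> H ->; rewrite mem_cat H !orbT.
- by rewrite rd eqxx.
- by case=> H ->; rewrite mem_cat inE H !orbT.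
Qed.

Lemma eq_cat2 (T : Type) (a b c d : seq T) :
  size a = size c -> a ++ b = c ++ d -> a = c /\ b = d.
Proof.
elim: a c => [|x a IH] [|y c] //= [] /IH{}IH [-> /IH [-> ->]] //.
Qed.

Lemma codes_morph (D E : eqType) (r : D -> D) (r' : E -> E) ts s t (phi : D -> E) :
  codes r ts s -> codes r' ts t -> map phi s = t ->
  {in s, forall d, phi (r d) = r' (phi d)}.
Proof.
move=> cs; elim: cs t => [|ts1 us1 d s1 t1 cs1 IH1 ct1 IH2 rd] t //.
move=> /codes_consI[d' [s2 [t2 [c2 d2 rd' ->]]]] /= [ed].
rewrite map_cat => /eq_cat2[]; first by rewrite size_map; apply: codes_size cs1 c2.
move=> /(IH1 _ c2) {}IH1 /= [ed' /(IH2 _ d2) {}IH2] x.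
rewrite !inE mem_cat inE => /orP[/eqP->|/orP[/IH1|/orP[/eqP->|/IH2]]] //.
- by rewrite ed' ed.
- by rewrite rd ed' ed.
Qed.

Lemma codes_map (D E : eqType) (r : D -> D) (r' : E -> E) ts s (g : D -> E) :
  codes r ts s -> {in s, forall d, r' (g d) = g (r d)} -> codes r' ts (map g s).
Proof.
move=> cs; elim: cs => [|ts1 us1 d s1 t1 cs1 IH1 ct1 IH2 rd] gr.
  exact: codes_nil.
have Hd : r' (g d) = g (r d) by apply: gr; rewrite inE eqxx.
have Hrd : r' (g (r d)) = g d.
  by rewrite gr ?rd // inE mem_cat inE eqxx !orbT.
rewrite /= map_cat /= -Hd; apply: codes_cons.
- by apply: IH1 => x xs; apply: gr; rewrite inE mem_cat xs orbT.
- by apply: IH2 => x xs; apply: gr; rewrite inE mem_cat inE xs !orbT.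
- by rewrite Hd.
Qed.

Lemma uniq_split (T : eqType) (x : T) a b c d :
  uniq (a ++ x :: b) -> a ++ x :: b = c ++ x :: d -> a = c /\ b = d.
Proof.
move=> u e; have := u; rewrite e => u'.
have xa : x \notin a by move: u; rewrite cat_uniq /= negb_or => /and3P[_ /andP[]].
have xc : x \notin c by move: u'; rewrite cat_uniq /= negb_or => /and3P[_ /andP[]].
have sz : size a = size c.
  have := congr1 (index x) e.
  by rewrite !index_cat (negbTE xa) (negbTE xc) /= eqxx !addn0.
by have [-> [->]] := eq_cat2 sz e.
Qed.

(** The reversal tells which letter closes each subtree, so that a word without
    repetition codes at most one forest. *)
Lemma codes_inj (D : eqType) (r : D -> D) ts us s :
  uniq s -> codes r ts s -> codes r us s -> ts = us.
Proof.
move=> + cs; elim: cs us => [|ts1 us1 d s1 t1 cs1 IH1 ct1 IH2 rd] us u.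
  by case: us => // -[vs] us /codes_consI[d [s1 [s2 []]]].
case: us => [/codes_nilI//|[vs] us /codes_consI[d' [s2 [t2 [c2 d2 rd' [ed]]]]]].
rewrite -{}ed {d'} in rd' *; move=> e.
move: u => /= /andP[_ u]; move: (u); rewrite cat_uniq /= => /and3P[u1 _ /andP[_ u2]].
case: (uniq_split u e) => e1 e2; subst.
by rewrite (IH1 vs) // (IH2 us).
Qed.

(** [fcodes r F s es]: the word [s] goes around the trees of [F] in turn, each of them
    being followed by one extra letter; [es] lists these extra letters. *)
Inductive fcodes (D : Type) (r : D -> D) : seq tree -> seq D -> seq D -> Prop :=
| fcodes_nil : fcodes r [::] [::] [::]
| fcodes_cons ts F s e t es : codes r ts s -> fcodes r F t es ->
    fcodes r (Node ts :: F) (s ++ e :: t) (e :: es).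

Lemma fcodes_nilI (D : Type) (r : D -> D) s es :
  fcodes r [::] s es -> s = [::] /\ es = [::].
Proof. by move=> cs; inversion cs. Qed.

Lemma fcodes_consI (D : Type) (r : D -> D) ts F s es : fcodes r (Node ts :: F) s es ->
  exists s1 e s2 es',
    [/\ codes r ts s1, fcodes r F s2 es', s = s1 ++ e :: s2 & es = e :: es'].
Proof.
move=> cs; inversion cs as [|ts' F' s1 e s2 es' c1 c2 e1 e2 e3]; subst.
by exists s1, e, s2, es'.
Qed.

Lemma fcodes_size (D E : Type) (r : D -> D) (r' : E -> E) F s t es es' :
  fcodes r F s es -> fcodes r' F t es' -> size s = size t /\ size es = size es'.
Proof.
move=> cs; elim: cs t es' => [|ts1 us1 s1 e1 t1 es1 c1 _ IH] t es'.
  by move=> /fcodes_nilI[-> ->].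
move=> /fcodes_consI[s2 [e2 [t2 [es2 [c2 /IH[e3 e4] -> ->]]]]].
by rewrite !size_cat /= (codes_size c1 c2) e3 e4.
Qed.

Lemma fcodes_sub (D : eqType) (r : D -> D) F s es :
  fcodes r F s es -> {subset es <= s}.
Proof.
elim=> // ts1 us1 s1 e1 t1 es1 c1 _ IH x.
by rewrite mem_cat !inE => /orP[->|/IH ->]; rewrite !orbT.
Qed.

Lemma fcodes_closed (D : eqType) (r : D -> D) F s es :
  fcodes r F s es ->
  {in s, forall d, d \in es \/ r d \in s /\ r (r d) = d}.
Proof.
elim=> // ts1 us1 s1 e1 t1 es1 c1 _ IH x.
rewrite !mem_cat !inE => /orP[/(codes_closed c1)[->]|/orP[->|/IH[->|[->]]]]; auto.
- by left; rewrite orbT.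
- by right; rewrite !orbT.
Qed.

Lemma fcodes_morph (D E : eqType) (r : D -> D) (r' : E -> E) F s t es es' (phi : D -> E) :
  fcodes r F s es -> fcodes r' F t es' -> map phi s = t ->
  map phi es = es' /\ {in s, forall d, d \in es \/ phi (r d) = r' (phi d)}.
Proof.
move=> cs; elim: cs t es' => [|ts1 F1 s1 e1 t1 es1 c1 _ IH] t es'.
  by move=> /fcodes_nilI[_ ->].
move=> /fcodes_consI[s2 [e2 [t2 [es2 [c2 d2 -> ->]]]]].
rewrite map_cat => /eq_cat2[].
  by rewrite size_map; apply: codes_size c1 c2.
move=> /(codes_morph c1 c2) m1 /= [-> /(IH _ _ d2) [-> m2]]; split=> // x.
rewrite mem_cat !inE => /orP[/m1->|/orP[->|/m2[->|]]]; auto.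
by left; rewrite orbT.
Qed.

Lemma fcodes_map (D E : eqType) (r : D -> D) (r' : E -> E) F s es (g : D -> E) :
  fcodes r F s es -> {in s, forall d, r' (g d) = g (r d)} ->
  fcodes r' F (map g s) (map g es).
Proof.
move=> cs; elim: cs => [|ts1 F1 s1 e1 t1 es1 c1 _ IH] gr.
  exact: fcodes_nil.
rewrite map_cat; apply: fcodes_cons.
- by apply: codes_map c1 _ => x xs; apply: gr; rewrite mem_cat xs.
- by apply: IH => x xs; apply: gr; rewrite mem_cat inE xs !orbT.
Qed.

(** The extra letters are those whose reverse is not in the word; they delimit the trees. *)
Lemma fcodes_inj (D : eqType) (r : D -> D) F G s es es' :
  uniq s -> {in es ++ es', forall e, r e \notin s} ->
  fcodes r F s es -> fcodes r G s es' -> F = G.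
Proof.
(* The induction shortens the word; [P] still refers to the letters of the whole word. *)
suff H (P : pred D) : uniq s -> {in es ++ es', forall e, ~~ P (r e)} -> {in s, forall d, P d} ->
    fcodes r F s es -> fcodes r G s es' -> F = G.
  by move=> u ne; apply: (H (mem s)).
move=> u ne sP cs; elim: cs G es' u ne sP => [|ts1 F1 s1 e1 t1 es1 c1 cF1 IH] G es' u ne sP.
  by case: G => // -[ts] G /fcodes_consI[[|? ?] [e [s2 [es2 []]]]].
case: G => [/fcodes_nilI[]|[ts] G]; first by case: s1 {c1 u sP}.
move=> /fcodes_consI[s2 [e2 [t2 [es2 [c2 d2 H es'E]]]]].
rewrite {}es'E {es'} in ne.
have sz : size s1 = size s2.
  have findE a e t : codes r a t -> ~~ P (r e) -> forall t', {subset t <= [pred d | P d]} ->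
      find [pred d | ~~ P (r d)] (t ++ e :: t') = size t.
    move=> ct ne' t' tP; rewrite find_cat ifF /= ?ne' ?addn0 //.
    apply/negbTE/hasPn => x xt; rewrite /= negbK.
    by apply: tP; have [] := codes_closed ct xt.
  rewrite -(findE _ e1 _ c1 _ t1); last first.
  - by move=> x xs; apply: sP; rewrite mem_cat xs.
  - by apply: ne; rewrite mem_cat !inE eqxx.
  rewrite H (findE _ _ _ c2) //.
  - by apply: ne; rewrite mem_cat !inE eqxx !orbT.
  - by move=> x xs; apply: sP; rewrite H mem_cat xs.
case: (eq_cat2 sz H) => e1' [_ e3]; subst.
move: u; rewrite cat_uniq /= => /and3P[u1 _ /andP[_ u2]].
rewrite (codes_inj u1 c1 c2); congr (_ :: _).
apply: (IH _ es2) => //.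
- move=> x; rewrite mem_cat => xe; apply: ne; rewrite mem_cat !inE.
  by case/orP: xe => ->; rewrite !orbT.
- by move=> x xt; apply: sP; rewrite mem_cat inE xt !orbT.
Qed.

(** * Cyclic sequences *)

(** Equality up to a cyclic shift. *)
Definition cyc (T : Type) (s t : seq T) : Prop := exists m, t = rot m s.

Lemma cycP (T : Type) (s t : seq T) :
  cyc s t <-> exists a b, s = a ++ b /\ t = b ++ a.
Proof.
split=> [[m ->]|[a [b [-> ->]]]].
  by exists (take m s), (drop m s); rewrite cat_take_drop.
by exists (size a); rewrite rot_size_cat.
Qed.

Lemma cyc_catC (T : Type) (a b : seq T) : cyc (a ++ b) (b ++ a).
Proof. by apply/cycP; exists a, b. Qed.

Lemma cyc_sym (T : Type) (s t : seq T) : cyc s t -> cyc t s.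
Proof. by move=> /cycP[a [b [-> ->]]]; apply: cyc_catC. Qed.

Lemma cyc_trans (T : Type) (s t u : seq T) : cyc s t -> cyc t u -> cyc s u.
Proof.
move=> [m ->] [k ->].
have rotmin k' (x : seq T) : rot k' x = rot (minn k' (size x)) x.
  by case: (leqP k' (size x)) => // /ltnW/rot_oversize ->; rewrite rot_size.
rewrite (rotmin m) (rotmin k) rot_add_mod ?size_rot ?geq_minr //.
by eexists.
Qed.

Lemma cyc_map (T U : Type) (g : T -> U) (s t : seq T) : cyc s t -> cyc (map g s) (map g t).
Proof. by move=> [m ->]; exists m; rewrite map_rot. Qed.

Lemma cyc_rev (T : Type) (s t : seq T) : cyc s t -> cyc (rev s) (rev t).
Proof. by move=> /cycP[a [b [-> ->]]]; rewrite !rev_cat; apply: cyc_catC. Qed.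

Lemma cyc_flatten (T : Type) (s t : seq (seq T)) : cyc s t -> cyc (flatten s) (flatten t).
Proof. by move=> /cycP[a [b [-> ->]]]; rewrite !flatten_cat; apply: cyc_catC. Qed.

Lemma cyc_perm (T : eqType) (s t : seq T) : cyc s t -> perm_eq s t.
Proof. by move=> [m ->]; rewrite perm_sym perm_rot. Qed.

Lemma cyc_mem (T : eqType) (s t : seq T) : cyc s t -> s =i t.
Proof. by move=> /cyc_perm/perm_mem. Qed.

Lemma cyc_uniq (T : eqType) (s t : seq T) : cyc s t -> uniq s = uniq t.
Proof. by move=> /cyc_perm/perm_uniq. Qed.

(** Without repetition, a cyclic sequence is determined by its last element. *)
Lemma cyc_rcons (T : eqType) (s t : seq T) x :
  uniq (rcons s x) -> cyc (rcons s x) (rcons t x) -> s = t.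
Proof.
rewrite -!cats1 => u co.
have {co} : cyc (x :: s) (x :: t).
  by apply: cyc_trans (cyc_catC t [:: x]); apply: cyc_trans co; apply: (cyc_catC [:: x] s).
move/cycP=> [[|y a] [[|z b] []]] //=.
- by rewrite cats0 => -[_ ->] [].
- by rewrite cats0 => -[_ ->] [].
move=> [_ es] [xz _].
rewrite -{}xz in es.
by move: u; rewrite es -catA cat_uniq /= !mem_cat !inE eqxx !orbT !andbF.
Qed.

Lemma cyc_cons (T : eqType) (x : T) (s t : seq T) :
  uniq (x :: s) -> cyc (x :: s) (x :: t) -> s = t.
Proof.
move=> u co; apply: (@cyc_rcons _ s t x).
  by rewrite -rot1_cons rot_uniq.
rewrite -!cats1; apply: cyc_trans (cyc_catC [:: x] t); apply: cyc_trans co.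
exact: (cyc_catC s [:: x]).
Qed.

Lemma cyc_filter (T : Type) (P : pred T) (s t : seq T) : cyc s t -> cyc (filter P s) (filter P t).
Proof. by move=> /cycP[a [b [-> ->]]]; rewrite !filter_cat; apply: cyc_catC. Qed.

Lemma cyc_rot_index (T : eqType) (x : T) a b t :
  uniq t -> cyc (a ++ x :: b) t -> rot (index x t) t = x :: b ++ a.
Proof.
move=> ut co; have xt : x \in t by rewrite -(cyc_mem co) mem_cat inE eqxx orbT.
have e : rot (index x t) t = x :: drop (index x t).+1 t ++ take (index x t) t.
  by rewrite /rot drop_index.
rewrite e; congr (_ :: _); apply: (@cyc_cons _ x).
  by rewrite -e rot_uniq.
rewrite -e; apply: cyc_trans (cyc_catC a (x :: b)); apply: cyc_trans (cyc_sym co).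
by apply: cyc_sym; exists (index x t).
Qed.

Lemma uniq_map_inj (T U : eqType) (g : T -> U) (s : seq T) :
  uniq (map g s) -> {in s &, injective g}.
Proof.
elim: s => //= z s IH /andP[zs /IH{}IH] x y; rewrite !inE.
move=> /orP[/eqP->|xs] /orP[/eqP->|ys] // e; last exact: IH.
- by rewrite e map_f in zs.
- by rewrite -e map_f in zs.
Qed.

(** * Maps representing a forest up to re-rooting *)

(** [represents M F s es]: up to re-rooting, [M] is the map of the forest [F]; its outer
    face, cut open at the right place, reads as the contour word [s] of [F] with extra
    letters [es], and its inner face consists of the reverses of the extra letters,
    in reverse order.  All these half-edges are distinct. *)
Definition represents (D : eqType) (M : cmap D) (F : seq tree) (s es : seq D) : Prop :=
  [/\ fcodes (rev_of M) F s es,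
      exists o g, [/\ faces M = [:: o; g], cyc s o & cyc (rev (map (rev_of M) es)) g],
      uniq (s ++ map (rev_of M) es) &
      {in es, cancel (rev_of M) (rev_of M)}].

Section Represents.

Variables (D : eqType) (M : cmap D) (F : seq tree) (s es : seq D).
Hypothesis rM : represents M F s es.
Let r := rev_of M.

Lemma represents_darts : perm_eq (darts M) (s ++ map r es).
Proof.
case: rM => _ [o [g [eM /cyc_perm co /cyc_perm cg]]] _ _.
rewrite /darts eM /= cats0; rewrite perm_sym; apply: perm_cat => //.
by rewrite -(permPr cg) perm_sym perm_rev.
Qed.

Lemma represents_mem d : (d \in darts M) = (d \in s) || (d \in map r es).
Proof. by rewrite (perm_mem represents_darts) mem_cat. Qed.

Lemma represents_rev : {in darts M, forall d, r d \in darts M /\ r (r d) = d}.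
Proof.
case: rM => fc _ _ rK d; rewrite !represents_mem /r => /orP[|/mapP[e ee ->]].
  move/(fcodes_closed fc) => [de|[-> ->]] //.
  by rewrite map_f ?orbT // rK.
by rewrite !(rK e ee) (fcodes_sub fc ee).
Qed.

Lemma represents_extra e : e \in es -> r e \notin s.
Proof.
case: rM => _ _ + _; rewrite cat_uniq => /and3P[_ /hasPn h _] ee.
by apply: h; apply: map_f.
Qed.

End Represents.

(** Two maps representing the same forest are isomorphic, by sending each letter of one
    contour word to the letter of the other one at the same position. *)
Lemma represents_iso (D E : eqType) (M : cmap D) (N : cmap E) (e0 : E) F s es t es' :
  represents M F s es -> represents N F t es' ->
  exists phi, map_iso M N phi /\ map phi s = t.
Proof.
move=> rM rN.
have memM := represents_mem rM; have pM := represents_darts rM.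
have pN := represents_darts rN; have revM := represents_rev rM.
have revN := represents_rev rN; have extraM := represents_extra rM.
case: rM => fcM [o [g [eM co cg]]] uM rMK.
case: rN => fcN [o' [g' [eN co' cg']]] uN rNK.
set rr := rev_of M in fcM cg uM rMK *; set rr' := rev_of N in fcN cg' uN rNK *.
have us : uniq s by move: uM; rewrite cat_uniq => /andP[].
have [sz1 sz2] := fcodes_size fcM fcN.
(* An edge of the inner face is sent to the reverse of the image of its reverse. *)
pose phi d := if d \in s then nth e0 t (index d s) else rr' (nth e0 t (index (rr d) s)).
have phis : map phi s = t.
  case: (s) us sz1 @phi => [|d0 s'] us sz1 phi; first by case: (t) sz1.
  apply: (@eq_from_nth _ e0); rewrite size_map // => i lti.
  by rewrite (nth_map d0) // /phi mem_nth // index_uniq.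
have [phie phir] := fcodes_morph fcM fcN phis.
have phire : {in es, forall e, phi (rr e) = rr' (phi e)}.
  move=> e ee; rewrite {1}/phi (negbTE (extraM e ee)) rMK // /phi.
  by rewrite (fcodes_sub fcM ee).
have phir' : {in s, forall d, phi (rr d) = rr' (phi d)}.
  by move=> d /phir[/phire|].
have phig : map phi (map rr es) = map rr' es'.
  by rewrite -phie -!map_comp; apply/eq_in_map => e ee /=; apply: phire.
exists phi; split=> //; split.
- by rewrite eM eN.
- case=> [|[|k]]; rewrite eM eN /=.
  + by apply: cyc_trans co'; rewrite -phis; apply/cyc_map/cyc_sym.
  + apply: cyc_trans cg'; rewrite -phig -map_rev; apply/cyc_map/cyc_sym.
    by rewrite -map_rev in cg *.
  + by exists 0; rewrite !nth_nil.
- have um : uniq (map phi (darts M)).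
    by rewrite (perm_uniq (perm_map phi pM)) map_cat phis phig.
  exact: uniq_map_inj.
- move=> d; rewrite memM => /orP[/phir'|/mapP[e ee ->]] //.
  rewrite -/rr -/rr' (rMK e ee) (phire e ee); have : phi e \in es' by rewrite -phie map_f.
  by move/rNK => ->.
Qed.

(** An isomorphism carries a representation to the target map. *)
Lemma represents_transport (D E : eqType) (M : cmap D) (N : cmap E) phi F s es :
  map_iso M N phi -> represents M F s es -> represents N F (map phi s) (map phi es).
Proof.
move=> [szf fac inj rv] rM.
have memM := represents_mem rM; have pM := represents_darts rM.
have revM := represents_rev rM; have extraM := represents_extra rM.
case: rM => fcM [o [g [eM co cg]]] uM rMK.
have sub : {in s, forall d, d \in darts M} by move=> d ds; rewrite memM ds.
have sube : {in es, forall d, d \in darts M} by move=> d /(fcodes_sub fcM)/sub.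
have rv' : map (rev_of N) (map phi es) = map phi (map (rev_of M) es).
  by rewrite -!map_comp; apply/eq_in_map => e /sube/rv.
split.
- by apply: (fcodes_map fcM) => d /sub/rv.
- exists (nth [::] (faces N) 0), (nth [::] (faces N) 1); split.
  + by move: szf; rewrite eM; case: (faces N) => [|? [|? []]].
  + have [m ->] := fac 0; rewrite eM /=.
    by apply: cyc_trans (cyc_map phi co) _; exists m.
  + have [m ->] := fac 1; rewrite eM /= rv' -map_rev.
    by apply: cyc_trans (cyc_map phi cg) _; exists m.
- rewrite rv' -map_cat map_inj_in_uniq // => x y.
  by rewrite -!(perm_mem pM); apply: inj.
- move=> _ /mapP[e ee ->]; have [h1 h2] := revM _ (sube _ ee).
  by rewrite -!rv // ?h2 // sube.
Qed.

(** * The map of a forest *)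

Lemma mem_kids i w k us d : d \in kids i w k us ->
  exists a w1 b, d = Edge i (w ++ (k + a) :: w1) b /\ tree_vertex (Node us) (a :: w1).
Proof.
elim/forest_ind: us w k => // ts us IHt IHu w k.
rewrite kids_cons inE mem_cat inE => /or4P[/eqP->|/IHt|/eqP->|/IHu].
- by exists 0, [::], false; rewrite addn0 cats1.
- move=> [a [w1 [b [-> h]]]]; exists 0, (a :: w1), b.
  by rewrite addn0 cat_rcons.
- by exists 0, [::], true; rewrite addn0 cats1.
- move=> [a [w1 [b [-> h]]]]; exists a.+1, w1, b.
  by rewrite addSnnS.
Qed.

Lemma kids_mem i w k us a w1 b : tree_vertex (Node us) (a :: w1) ->
  Edge i (w ++ (k + a) :: w1) b \in kids i w k us.
Proof.
elim/forest_ind: us w k a w1 b => // ts us IHt IHu w k [|a] w1 b.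
  rewrite kids_cons inE mem_cat inE addn0.
  case: w1 => [|a w1] /=; first by rewrite cats1; case: b; rewrite eqxx ?orbT.
  by move/IHt => /(_ (rcons w k) 0 b); rewrite cat_rcons add0n => ->; rewrite orbT.
move/IHu => /(_ w k.+1 b); rewrite addSnnS.
by rewrite kids_cons !(inE, mem_cat) => ->; rewrite !orbT.
Qed.

Lemma kids_uniq i w k us : uniq (kids i w k us).
Proof.
elim/forest_ind: us w k => // ts us IHt IHu w k.
have h1 b : Edge i (rcons w k) b \notin kids i (rcons w k) 0 ts.
  apply/negP => /mem_kids[a [w1 [b' [[/(congr1 size)]]]]].
  by rewrite size_cat /=; lia.
have h2 w' b : Edge i (rcons w k ++ w') b \notin kids i w k.+1 us.
  apply/negP => /mem_kids[a [w1 [b' [[/eqP]]]]].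
  by rewrite cat_rcons eqseq_cat // eqxx /= eqseq_cons => /andP[/eqP]; lia.
have h3 b : Edge i (rcons w k) b \notin kids i w k.+1 us.
  by have := h2 [::] b; rewrite cats0.
rewrite kids_cons /= cat_uniq /= IHt IHu mem_cat inE !negb_or !h1 !h3 /= andbT.
rewrite andbT; apply/andP; split; first by apply/eqP => -[].
apply/hasPn => d dk; apply/negP => /= /mem_kids[a [w1 [b [ed _]]]].
by move: dk; rewrite ed; apply/negP.
Qed.

Lemma codes_kids i w k us : codes flip us (kids i w k us).
Proof.
elim/forest_ind: us w k => [|ts us IHt IHu] w k; first exact: codes_nil.
by rewrite kids_cons; apply: (@codes_cons _ flip).
Qed.

(** The contour of the trees [f] when the indices [l] are used as their names. *)
Definition fcontour (l : seq nat) (f : seq tree) : seq dart :=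
  flatten [seq rcons (tree_contour x.1 [::] x.2) (Extra x.1 true) | x <- zip l f].

Lemma fcontour_cons i l ts f :
  fcontour (i :: l) (Node ts :: f) = kids i [::] 0 ts ++ Extra i true :: fcontour l f.
Proof.
suff H t : fcontour (i :: l) (t :: f) =
    kids i [::] 0 (children t) ++ Extra i true :: fcontour l f by exact: H.
by rewrite /fcontour /= tree_contourE cat_rcons.
Qed.

Lemma contourE f : contour f = fcontour (iota 0 (size f)) f.
Proof.
rewrite /contour /fcontour; congr flatten.
apply: (@eq_from_nth _ [::]); first by rewrite !size_map size_zip size_iota minnn.
move=> i; rewrite size_map size_iota => lti.
rewrite (nth_map 0) ?size_iota // (nth_map (0, Node [::])); last first.
  by rewrite size_zip size_iota minnn.
by rewrite nth_zip ?size_iota // nth_iota.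
Qed.

Lemma zip_rot (T U : Type) m (s : seq T) (t : seq U) :
  size s = size t -> zip (rot m s) (rot m t) = rot m (zip s t).
Proof.
move=> sz; rewrite /rot zip_cat ?size_drop ?sz //.
congr (_ ++ _).
  by elim: s t m {sz} => [|x s IH] [|y t] [|m] //=; case: drop.
by elim: s t m {sz} => [|x s IH] [|y t] [|m] //=; rewrite IH.
Qed.

Lemma fcontour_rot m l f : size l = size f ->
  cyc (fcontour l f) (fcontour (rot m l) (rot m f)).
Proof.
move=> sz; rewrite /fcontour zip_rot // map_rot.
by apply: cyc_flatten; exists m.
Qed.

Lemma mem_contour f d : d \in contour f ->
  (exists i w b, [/\ d = Edge i w b, i < size f, w != [::] & tree_vertex (nth (Node [::]) f i) w])
  \/ (exists2 i, i < size f & d = Extra i true).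
Proof.
move=> /flatten_mapP[i]; rewrite mem_iota add0n => /= lti.
rewrite mem_rcons inE tree_contourE => /orP[/eqP->|]; first by right; exists i.
move=> /mem_kids[a [w [b [-> h]]]]; left; exists i, (a :: w), b.
by split=> //; case: (nth _ _ _) h.
Qed.

Lemma edge_contour f i w b : i < size f -> w != [::] ->
  tree_vertex (nth (Node [::]) f i) w -> Edge i w b \in contour f.
Proof.
move=> lti w0 h; apply/flatten_mapP; exists i; first by rewrite mem_iota.
rewrite mem_rcons inE tree_contourE; apply/orP; right.
case: w w0 h => // a w _ h; apply: (kids_mem i [::] 0).
by case: (nth _ _ _) h.
Qed.

Lemma extra_contour f i b : (Extra i b \in contour f) = b && (i < size f).
Proof.
apply/idP/andP => [|[-> lti]].
  by case/mem_contour => [[? [? [? []]]]|[j lti [-> ->]]].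
by apply/flatten_mapP; exists i; rewrite ?mem_iota // mem_rcons inE eqxx.
Qed.

Lemma mem_fcontour l f d : d \in fcontour l f ->
  (exists i w b, d = Edge i w b /\ i \in l) \/ (exists2 i, d = Extra i true & i \in l).
Proof.
elim: l f => [|i l IH] [|[ts] f] //; rewrite fcontour_cons mem_cat inE => /or3P[|/eqP->|].
- by move=> /mem_kids[a [w1 [b [-> _]]]]; left; exists i, (a :: w1), b; rewrite mem_head.
- by right; exists i => //; rewrite mem_head.
- by move=> /IH[[j [w [b [-> jl]]]]|[j -> jl]]; [left; exists j, w, b|right; exists j];
    rewrite // inE jl orbT.
Qed.

Lemma fcontour_uniq l f : uniq l -> uniq (fcontour l f).
Proof.
elim: l f => [|i l IH] [|[ts] f] // /andP[il ul].
rewrite fcontour_cons cat_uniq kids_uniq /= IH // andbT.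
have ne : Extra i true \notin fcontour l f.
  by apply/negP => /mem_fcontour[[j [w [b []]]]|[j [<-]]] //; apply/negP.
rewrite ne andbT negb_or; apply/andP; split.
  by apply/negP => /mem_kids[? [? [? []]]].
apply/hasPn => d; move/mem_fcontour => [[j [w [b [-> jl]]]]|[j -> jl]].
- by apply/negP => /mem_kids[a [w1 [b' [[ji _ _] _]]]]; rewrite -ji jl in il.
- by apply/negP => /mem_kids[a [w1 [b' []]]].
Qed.

Lemma contour_uniq f : uniq (contour f).
Proof. by rewrite contourE fcontour_uniq // iota_uniq. Qed.

Lemma flipK : involutive flip.
Proof. by case=> [i w b|i b] /=; rewrite negbK. Qed.

Lemma fcodes_fcontour l f : size l = size f ->
  fcodes flip f (fcontour l f) [seq Extra i true | i <- l].
Proof.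
elim: l f => [|i l IH] [|[ts] f] //=; first by move=> _; apply: fcodes_nil.
by move=> [/IH h]; rewrite fcontour_cons; apply: fcodes_cons => //; apply: codes_kids.
Qed.

(** The original indices of the trees of [rot r f]. *)
Definition flabels r (f : seq tree) := rot r (iota 0 (size f)).
(** The contour of [f], started at the tree of index [r]. *)
Definition rcontour r (f : seq tree) := fcontour (flabels r f) (rot r f).

Lemma cyc_rcontour r f : cyc (rcontour r f) (contour f).
Proof. by apply: cyc_sym; rewrite contourE; apply: fcontour_rot; rewrite size_iota. Qed.

Lemma rcontour_uniq r f : uniq (rcontour r f).
Proof. by rewrite (cyc_uniq (cyc_rcontour r f)) contour_uniq. Qed.

(** The map of a forest represents each re-rooting of the forest. *)
Lemma represents_forest_map r f :
  represents (forest_map f) (rot r f) (rcontour r f) [seq Extra i true | i <- flabels r f].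
Proof.
have flE : [seq flip d | d <- [seq Extra i true | i <- flabels r f]]
  = [seq Extra i false | i <- flabels r f] by rewrite -map_comp.
split=> /=.
- by apply: fcodes_fcontour; rewrite !size_rot size_iota.
- exists (contour f), [seq Extra i false | i <- rev (iota 0 (size f))]; split=> //.
    exact: cyc_rcontour.
  rewrite flE -map_rev; apply/cyc_map/cyc_rev/cyc_sym.
  by exists r.
- rewrite flE cat_uniq rcontour_uniq /= map_inj_uniq ?rot_uniq ?iota_uniq ?andbT; last first.
    by move=> i j [].
  apply/hasPn => _ /mapP[i _ ->]; rewrite /= (cyc_mem (cyc_rcontour r f)).
  by rewrite extra_contour.
- by move=> e _; apply: flipK.
Qed.

(** Conversely, the map of a forest represents only the re-rootings of this forest, and
    only through their contours: the last letter of the word must be an extra half-edge,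
    which determines where the contour is cut open. *)
Lemma represents_rigid f F s es : 0 < size f ->
  represents (forest_map f) F s es ->
  exists2 r, r < size f & F = rot r f /\ s = rcontour r f.
Proof.
move=> f0 rep.
have [fc [o [g [[eo eg] co cg]]] us _] := rep; rewrite -{o}eo in co.
rewrite -{g}eg in cg.
have Ne : es != [::].
  apply/eqP => es0; move: cg; rewrite es0 => /cyc_perm/perm_size.
  by rewrite /= size_map size_rev size_iota => f0'; rewrite -f0' in f0.
(* The last letter of [s] is an extra half-edge [Extra k true], so that [s] starts with
   the tree that cyclically follows the [k]-th one. *)
have [es' [e ese]] : exists es' e, es = rcons es' e.
  by case/lastP: es Ne {fc cg us rep} => // es' e _; exists es', e.
have [s' se] : exists s', s = rcons s' e.
  move: fc; rewrite ese; elim: F s es' {co us cg rep ese} => [|[ts] F IH] s es'.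
    by move=> /fcodes_nilI[_]; case: es'.
  move=> /fcodes_consI[s1 [e1 [s2 [es2 [_ c2 -> eses]]]]].
  case: es' eses => [[-> e2]|e' es' [_ e2]].
    move: c2; rewrite -e2; case: F {IH} => [/fcodes_nilI[->]|[ts'] F].
      by exists s1; rewrite cats1.
    by move=> /fcodes_consI[? [? [? [? []]]]].
  move: c2; rewrite -e2 => /IH[s' ->].
  by exists (s1 ++ e1 :: s'); rewrite rcons_cat.
have [k ltk ek] : exists2 k, k < size f & e = Extra k true.
  have : flip e \in [seq flip d | d <- es] by rewrite map_f // ese mem_rcons mem_head.
  rewrite -mem_rev (cyc_mem cg) => /mapP[k]; rewrite mem_rev mem_iota add0n => /= ltk.
  by move/(congr1 flip); rewrite flipK => ->; exists k.
pose r := if k.+1 < size f then k.+1 else 0.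
exists r; first by rewrite /r; case: ifP.
have rE (T : Type) (t : seq T) : size t = size f -> rot r t = rot k.+1 t.
  rewrite /r; case: ltnP => // le1 szt; rewrite rot0 rot_oversize //.
  by rewrite szt.
have [s2 s2E] : exists s2, rcontour r f = rcons s2 (Extra k true).
  rewrite /rcontour /flabels !rE ?size_iota //.
  have -> : rot k.+1 (iota 0 (size f)) =
      rcons (drop k.+1 (iota 0 (size f)) ++ take k (iota 0 (size f))) k.
    rewrite /rot (take_nth 0) ?size_iota // nth_iota // add0n rcons_cat //.
  have : 0 < size (rot k.+1 f) by rewrite size_rot.
  have : size (rot k.+1 f) =
      size (rcons (drop k.+1 (iota 0 (size f)) ++ take k (iota 0 (size f))) k).
    rewrite size_rot size_rcons size_cat size_drop size_take size_iota ltk; lia.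
  elim: (_ ++ _) (rot _ _) => [|l ls IH] [|[ts] F'] //.
  - case: F' => // _ _; exists (kids k [::] 0 ts); by rewrite /= fcontour_cons cats1.
  - move=> [szE] _; rewrite rcons_cons fcontour_cons.
    case: (IH F') => [||s2 ->] //=; first by rewrite szE size_rcons.
    by exists (kids l [::] 0 ts ++ Extra l true :: s2); rewrite rcons_cat.
have ss2 : s' = s2.
  apply: (@cyc_rcons _ _ _ (Extra k true)).
    by move: us; rewrite cat_uniq se ek => /andP[].
  rewrite -ek -se ek -s2E; apply: cyc_trans co _; apply: cyc_sym.
  exact: cyc_rcontour.
have sr : s = rcontour r f by rewrite s2E -ss2 se ek.
split=> //.
have rf := represents_forest_map r f.
have [fc' _ _ _] := rf.
move: fc; rewrite sr => fc.
apply: (fcodes_inj (rcontour_uniq r f) _ fc fc').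
move=> d; rewrite mem_cat => /orP[|].
  by move=> de; rewrite -sr; apply: (represents_extra rep).
by apply: (represents_extra rf).
Qed.

(** * Grafting *)

(** [graft w k m ts T1 T2]: replacing a tree with subtrees [ts] by two consecutive trees
    with subtrees [T1] and [T2] amounts to inserting one closing letter at the corner
    number [k] of the vertex [w], after the first [m] letters of the contour of [ts].
    In both [ts] and [T1], the address of the vertex is [w].  The subtrees on the right
    of the branch leading to the corner are pushed one level up, those hanging from the
    root making up the second tree. *)
Inductive graft : seq nat -> nat -> nat -> seq tree -> seq tree -> seq tree -> Prop :=
| graft_nil C A : graft [::] (size C) (size (kids 0 [::] 0 C)) (C ++ A) C A
| graft_cons w k m ts T1 T2 C A : graft w k m ts T1 T2 ->
    graft (size C :: w) k ((size (kids 0 [::] 0 C) + m).+1)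
      (C ++ Node ts :: A) (C ++ Node T1 :: T2) A.

(** The two lists [T1] and [T2] of a graft, computed from the corner. *)
Fixpoint graft_up (ts : seq tree) (w : seq nat) (k : nat) : seq tree * seq tree :=
  if w is a :: w' then
    let T := graft_up (children (nth (Node [::]) ts a)) w' k in
    (take a ts ++ Node T.1 :: T.2, drop a.+1 ts)
  else (take k ts, drop k ts).

(** The list [ts] and the corner number [k] of a graft, computed from the vertex. *)
Fixpoint graft_down (T1 : seq tree) (w : seq nat) (T2 : seq tree) : seq tree * nat :=
  if w is a :: w' then
    let T := graft_down (children (nth (Node [::]) T1 a)) w' (drop a.+1 T1) in
    (take a T1 ++ Node T.1 :: T2, T.2)
  else (T1 ++ T2, size T1).

(** The subtrees hanging from the vertex of address [w]. *)
Fixpoint subforest (ts : seq tree) (w : seq nat) : seq tree :=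
  if w is a :: w' then subforest (children (nth (Node [::]) ts a)) w' else ts.

Lemma graft_upP ts w k : tree_vertex (Node ts) w -> k <= size (subforest ts w) ->
  exists m, graft w k m ts (graft_up ts w k).1 (graft_up ts w k).2.
Proof.
elim: w ts => [|a w IH] ts /=.
  move=> _ lek; have := graft_nil (take k ts) (drop k ts).
  by rewrite cat_take_drop size_takel // => gr; eexists; exact: gr.
move=> /andP[lta]; case E: (nth _ ts a) => [us] /= vw lek.
have [m g] := IH us vw lek.
have := graft_cons (take a ts) (drop a.+1 ts) g; rewrite size_takel ?(ltnW lta) //.
by rewrite -E -drop_nth // cat_take_drop => gr; eexists; exact: gr.
Qed.

Lemma graft_downP T1 w T2 : tree_vertex (Node T1) w ->
  exists m, graft w (graft_down T1 w T2).2 m (graft_down T1 w T2).1 T1 T2.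
Proof.
elim: w T1 T2 => [|a w IH] T1 T2 /=; first by eexists; apply: graft_nil.
move=> /andP[lta]; case E: (nth _ T1 a) => [us] /= vw.
have [m g] := IH us (drop a.+1 T1) vw.
have := graft_cons (take a T1) T2 g; rewrite size_takel ?(ltnW lta) //.
by rewrite -E -drop_nth // cat_take_drop => gr; eexists; exact: gr.
Qed.

Lemma graft_edges w k m ts T1 T2 : graft w k m ts T1 T2 ->
  tree_edges (Node ts) = tree_edges (Node T1) + tree_edges (Node T2).
Proof.
elim=> [C A|w' k' m' ts' T1' T2' C A _] /=; rewrite !map_cat !sumn_cat //=; lia.
Qed.

Lemma graft_vertex w k m ts T1 T2 : graft w k m ts T1 T2 -> tree_vertex (Node T1) w.
Proof.
elim=> // w' k' m' ts' T1' T2' C A _ IH /=.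
by rewrite size_cat /= nth_cat ltnn subnn IH; lia.
Qed.

Lemma graft_source_vertex w k m ts T1 T2 : graft w k m ts T1 T2 ->
  tree_vertex (Node ts) w.
Proof.
elim=> // w' k' m' ts' T1' T2' C A _ IH /=.
by rewrite size_cat /= nth_cat ltnn subnn IH; lia.
Qed.

(** The half-edge that ends the visit of the vertex [w] by the contour.  This puts the
    vertices of a forest in bijection with the half-edges of its contour that are not
    directed downwards. *)
Definition close i (w : seq nat) := if w is [::] then Extra i true else Edge i w true.

(** The half-edge representing the corner number [k] of the vertex of address [w] in the
    forest [ts] hanging from [w0]: it leads to the [k]-th child if there is one, and
    leaves the vertex for good otherwise. *)
Fixpoint corner i (w0 : seq nat) (ts : seq tree) (w : seq nat) (k : nat) : dart :=
  if w is a :: w' then corner i (rcons w0 a) (children (nth (Node [::]) ts a)) w' k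
  else if k < size ts then Edge i (rcons w0 k) false else close i w0.

(** The half-edges climbing from [w0 ++ w] to [w0]. *)
Fixpoint upward i (w0 w : seq nat) : seq dart :=
  if w is a :: w' then rcons (upward i (rcons w0 a) w') (Edge i (rcons w0 a) true)
  else [::].

Section Splice.

Variables (D : eqType) (r : D -> D) (z : D).

(** The contour words of a graft.  [splice ts T1 T2 s1 s2 xs q X Y sd] says that inserting
    [z] between [s1] and [s2] turns the word [s1 ++ s2] around [ts] into
    [X ++ last z q :: Y], where [X] and [Y] go around [T1] and [T2].  The lists [xs] and
    [q], ordered from the insertion point to the root, contain the descending and the
    climbing letters of the branch; the other letters are those of [sd].  Only the
    reversal of the latter is prescribed: the climbing letter of the edge descended by
    the [k]-th letter of [xs] is the [k]-th letter of [q] before the insertion, and the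
    [k]-th letter of [z :: q] after it. *)
Inductive splice : seq tree -> seq tree -> seq tree ->
    seq D -> seq D -> seq D -> seq D -> seq D -> seq D -> seq D -> Prop :=
| splice_nil C A X Y : codes r C X -> codes r A Y ->
    splice (C ++ A) C A X Y [::] [::] X Y (X ++ Y)
| splice_cons ts T1 T2 s1 s2 xs q X Y sd C A X' Y' x y :
    splice ts T1 T2 s1 s2 xs q X Y sd -> codes r C X' -> codes r A Y' ->
    splice (C ++ Node ts :: A) (C ++ Node T1 :: T2) A
      (X' ++ x :: s1) (s2 ++ y :: Y') (rcons xs x) (rcons q y)
      (X' ++ x :: X ++ last z q :: Y) Y' (X' ++ sd ++ Y').

Variables (ts T1 T2 : seq tree) (s1 s2 xs q X Y sd : seq D).
Hypothesis sp : splice ts T1 T2 s1 s2 xs q X Y sd.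

Lemma splice_cat : s1 ++ z :: s2 = X ++ last z q :: Y.
Proof.
elim: sp => // ts' T1' T2' s1' s2' xs' q' X1 Y1 sd' C A X' Y' x y _ IH _ _.
rewrite last_rcons -!catA /=; congr (_ ++ _ :: _).
by rewrite -cat_cons catA IH -catA.
Qed.

Lemma splice_perm : perm_eq (s1 ++ s2) (sd ++ xs ++ q).
Proof.
elim: sp => [*|ts' T1' T2' s1' s2' xs' q' X1 Y1 sd' C A X' Y' x y _ IH _ _].
  by rewrite /= cats0 perm_refl.
apply/permP => P; have /permP/(_ P) := IH.
rewrite -!cats1 !count_cat /= ?count_cat; lia.
Qed.

(** The matching of the branch before the insertion. *)
Lemma splice_old (r' : D -> D) : {in sd, r =1 r'} ->
  map r' xs = q -> map r' q = xs -> codes r' ts (s1 ++ s2).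
Proof.
elim: sp => [C A X1 Y1 cC cA rr _ _
  |ts' T1' T2' s1' s2' xs' q' X1 Y1 sd' C A X' Y' x y _ IH cC cA rr].
  apply: codes_cat; apply: eq_codes; eauto => d dX; apply: rr; rewrite mem_cat dX ?orbT //.
rewrite !map_rcons => /rcons_inj[e1 e2] /rcons_inj[e3 e4].
rewrite -catA /= -e2; apply: codes_cat.
  by apply: eq_codes cC => d dX; apply: rr; rewrite !mem_cat dX.
rewrite catA; apply: codes_cons.
- by apply: IH => // d dX; apply: rr; rewrite !mem_cat dX orbT.
- by apply: eq_codes cA => d dX; apply: rr; rewrite !mem_cat dX !orbT.
- by rewrite e2.
Qed.

(** The matching of the branch after the insertion. *)
Lemma splice_new (r' : D -> D) : {in sd, r =1 r'} ->
  map r' xs = belast z q -> map r' (belast z q) = xs ->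
  codes r' T1 X /\ codes r' T2 Y.
Proof.
elim: sp => [C A X1 Y1 cC cA rr _ _
  |ts' T1' T2' s1' s2' xs' q' X1 Y1 sd' C A X' Y' x y _ IH cC cA rr].
  split; apply: eq_codes; eauto => d dX; apply: rr; rewrite mem_cat dX ?orbT //.
rewrite belast_rcons lastI !map_rcons => /rcons_inj[e1 e2] /rcons_inj[e3 e4].
have rr1 : {in sd', r =1 r'} by move=> d dX; apply: rr; rewrite !mem_cat dX orbT.
have [c1 c2] := IH rr1 e1 e3.
split; last by apply: eq_codes cA => d dX; apply: rr; rewrite !mem_cat dX !orbT.
apply: codes_cat; first by apply: eq_codes cC => d dX; apply: rr; rewrite !mem_cat dX.
by rewrite -e2; apply: codes_cons; rewrite ?e2.
Qed.

End Splice.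

Lemma size_kids i w k us : size (kids i w k us) = size (kids 0 [::] 0 us).
Proof. exact: codes_size (codes_kids _ _ _ _) (codes_kids _ _ _ _). Qed.

Section Label.

Variables (D : eqType) (r : D -> D) (g : dart -> D).
Hypothesis rg : forall d, r (g d) = g (flip d).

Lemma codes_map_kids i w k us : codes r us (map g (kids i w k us)).
Proof. by apply: codes_map (codes_kids _ _ _ _) _ => d _; apply: rg. Qed.

(** The contour of [ts] gives the words of a graft before the insertion of a letter [z]. *)
Lemma graft_splice_up w k m ts T1 T2 i w0 z : graft w k m ts T1 T2 ->
  exists s1 s2 X Y sd,
  [/\ splice r z ts T1 T2 (map g s1) (map g s2)
        (map g (map flip (upward i w0 w))) (map g (upward i w0 w)) X Y (map g sd),
      kids i w0 0 ts = s1 ++ s2, size s1 = m &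
      head (close i w0) s2 = corner i w0 ts w k].
Proof.
move=> gr; elim: gr w0 => {w k m ts T1 T2} [C A|w k m ts T1 T2 C A _ IH] w0.
  exists (kids i w0 0 C), (kids i w0 (size C) A).
  do 3!eexists; split.
  - rewrite /=; have := splice_nil z (codes_map_kids i w0 0 C) (codes_map_kids i w0 (size C) A).
    rewrite -map_cat; apply.
  - by rewrite kids_cat.
  - exact: size_kids.
  - rewrite /= size_cat; case: A => [|a A] /=; first by rewrite addn0 ltnn.
    by rewrite ifT //; lia.
have [s1 [s2 [X [Y [sd [sp e sz hd]]]]]] := IH (rcons w0 (size C)).
exists (kids i w0 0 C ++ Edge i (rcons w0 (size C)) false :: s1).
exists (s2 ++ Edge i (rcons w0 (size C)) true :: kids i w0 (size C).+1 A).
do 3!eexists; split.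
- rewrite /= !map_rcons !map_cat /=.
  have := splice_cons (g (Edge i (rcons w0 (size C)) false))
    (g (Edge i (rcons w0 (size C)) true)) sp
    (codes_map_kids i w0 0 C) (codes_map_kids i w0 (size C).+1 A).
  rewrite -!map_cat; apply.
- by rewrite kids_cat kids_cons e -!catA /=.
- by rewrite size_cat /= sz addnS (size_kids i w0).
- rewrite /= nth_cat ltnn subnn /= -hd.
  by case: (s2) => //=; case: (w0).
Qed.

(** The contours of [T1] and [T2] give the words of a graft once the closing letter [h] of
    the vertex [w] has been inserted. *)
Lemma graft_splice_down w k m ts T1 T2 i w0 Y h q : graft w k m ts T1 T2 ->
  codes r T2 (map g Y) -> h :: q = rcons (upward i w0 w) (close i w0) ->
  exists s1 s2 sd,
  [/\ splice r (g h) ts T1 T2 (map g s1) (map g s2)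
        (map g (map flip (upward i w0 w))) (map g q)
        (map g (kids i w0 0 T1)) (map g Y) (map g sd),
      h = close i (w0 ++ w) & size s1 = m].
Proof.
move=> gr; elim: gr w0 Y h q => {w k m ts T1 T2} [C A|w k m ts T1 T2 C A _ IH] w0 Y h q cA.
  move=> /= [-> ->]; exists (kids i w0 0 C), Y, (kids i w0 0 C ++ Y).
  split; last exact: size_kids.
  - rewrite map_cat; apply: splice_nil => //; exact: codes_map_kids.
  - by rewrite cats0.
case/lastP: q => [|q e] /=.
  by move/(congr1 size); rewrite !size_rcons.
rewrite -rcons_cons => /rcons_inj[ehq ->].
have ce : close i (rcons w0 (size C)) = Edge i (rcons w0 (size C)) true.
  by case: (w0).
have cT2 := codes_map_kids i w0 (size C).+1 T2.
have [s1 [s2 [sd [sp eh sz]]]] :=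
  IH (rcons w0 (size C)) _ h q cT2 (etrans ehq (congr1 _ (esym ce))).
exists (kids i w0 0 C ++ Edge i (rcons w0 (size C)) false :: s1).
exists (s2 ++ close i w0 :: Y).
exists (kids i w0 0 C ++ sd ++ Y); split.
- have := splice_cons (g (Edge i (rcons w0 (size C)) false)) (g (close i w0)) sp
    (codes_map_kids i w0 0 C) cA.
  rewrite kids_cat kids_cons last_map.
  have -> : last h q = Edge i (rcons w0 (size C)) true.
    by rewrite -[last h q]/(last h (h :: q)) ehq last_rcons.
  by rewrite /= !map_rcons !map_cat /= map_cat.
- by rewrite eh cat_rcons.
- by rewrite size_cat /= sz addnS (size_kids i w0).
Qed.

End Label.

(** * Paths and corners *)

Lemma parent_rcons w a : parent (rcons w a) = w.
Proof. by rewrite /parent size_rcons -cats1 take_size_cat. Qed.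

Lemma upward_rcons i w0 w a :
  upward i w0 (rcons w a) = Edge i (w0 ++ rcons w a) true :: upward i w0 w.
Proof. by elim: w w0 => [|b w IH] w0 /=; rewrite ?cats1 // IH cat_rcons. Qed.

Lemma tree_vertex_parent t w a : tree_vertex t (rcons w a) -> tree_vertex t w.
Proof.
elim: w t => [|b w IH] [ts] //= /andP[-> /IH //].
Qed.

(** A half-edge leaving a vertex climbs, descends, or leaves a root for the next one. *)
Lemma contour_org f i w d : d \in contour f -> org (size f) d = (i, w) ->
  [\/ d = Edge i w true /\ w != [::], exists k, d = Edge i (rcons w k) false |
      d = Extra i true /\ w = [::]].
Proof.
case/mem_contour => [[j [w' [[] [-> _ w0 _]]]]|[j _ ->]] /=.
- by move=> [<- <-]; constructor 1.
- case/lastP: w' w0 => // w' k _; rewrite parent_rcons => -[<- <-].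
  by constructor 2; exists k.
- by rewrite /tree_root => -[<- <-]; constructor 3.
Qed.

Section Paths.
Variable f : seq tree.
Let target := tgt (size f).

Lemma is_path_last v q v' : is_path f v q v' -> last v (map target q) = v'.
Proof. by elim: q v => [|d q IH] v /=; [move/eqP|move=> /and3P[_ _ /IH]]. Qed.

Lemma self_avoiding_loop v q : self_avoiding f v q v -> q = [::].
Proof.
case: q => // d q /andP[/is_path_last /= e]; rewrite -/target.
by move: (mem_last (target d) (map target q)); rewrite e => ->.
Qed.

Lemma self_avoiding_cons v d q v' : self_avoiding f v (d :: q) v' ->
  [/\ d \in contour f, org (size f) d = v & self_avoiding f (target d) q v'].
Proof. by case/andP=> /= /and3P[-> /eqP -> p] /and3P[_ n u]; rewrite /self_avoiding p /= n u. Qed.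

(** A path that enters the subtree of the [k]-th child of [w] and ends at a root has to go
    through [w]. *)
Lemma descend_back i w k u q j : is_path f (i, rcons w k ++ u) q (tree_root j) ->
  (i, w) \in map target q.
Proof.
elim: q u => [|d q IH] u /=; first by case/eqP; case: w.
move=> /and3P[dc /eqP e]; rewrite inE.
case: (contour_org dc e) => [[-> _]|[k' ->]|[_]]; last by case: w e {IH}.
- case/lastP: u e {dc} => [|u a] e.
    by rewrite cats0 /target /tgt /= parent_rcons eqxx.
  by rewrite /target /tgt /= -rcons_cat parent_rcons => /IH ->; rewrite orbT.
- by rewrite /target /tgt /= rcons_cat => /IH ->; rewrite orbT.
Qed.

Lemma self_avoiding_step i w d q j : self_avoiding f (i, w) (d :: q) (tree_root j) ->
  d = close i w.
Proof.
move=> sa; have [dc e _] := self_avoiding_cons sa.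
case: (contour_org dc e) => [[-> ]|[k dE]|[-> ->]] //; first by case: (w).
case/andP: sa => /and3P[_ _]; rewrite dE /tgt /= -[rcons w k]cats0.
by move/descend_back; rewrite inE -/target => ->; rewrite orbT.
Qed.

Lemma self_avoiding_upward i w q j : self_avoiding f (i, w) q (tree_root j) ->
  exists2 q2, q = upward i [::] w ++ q2 & self_avoiding f (tree_root i) q2 (tree_root j).
Proof.
elim/last_ind: w q => [|w a IH] q; first by exists q.
case: q => [/andP[/eqP[_]]|d q sa]; first by case: w {IH}.
have := self_avoiding_step sa; have [_ _ sa'] := self_avoiding_cons sa.
have -> : close i (rcons w a) = Edge i (rcons w a) true by case: (w).
move=> dE; move: sa'; rewrite dE /target /tgt /= parent_rcons => /IH[q2 -> ?].
by exists q2 => //; rewrite upward_rcons.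
Qed.

Lemma upward_unique i w q : self_avoiding f (i, w) q (tree_root i) -> q = upward i [::] w.
Proof. by move/self_avoiding_upward=> [q2 -> /self_avoiding_loop ->]; rewrite cats0. Qed.

Lemma upward_next_unique i w q : next_tree (size f) i != i ->
  self_avoiding f (i, w) q (tree_root (next_tree (size f) i)) ->
  q = rcons (upward i [::] w) (Extra i true).
Proof.
move=> ni /self_avoiding_upward[[|d q2] ->].
  by case/andP => /eqP[e]; rewrite -e eqxx in ni.
move=> sa; have := self_avoiding_step sa => /= dE; rewrite dE in sa *.
have [_ _] := self_avoiding_cons sa; rewrite /target /tgt /= => /self_avoiding_loop ->.
by rewrite cats1.
Qed.

Lemma upward_target i w x : x \in map target (upward i [::] w) ->
  x.1 = i /\ size x.2 < size w.
Proof.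
elim/last_ind: w => // w a IH; rewrite upward_rcons inE size_rcons => /orP[/eqP->|/IH[-> lt]].
  by rewrite /target /tgt /= parent_rcons.
by split=> //; apply: ltnW.
Qed.

Lemma upward_path i w q v : is_vertex f (i, w) -> is_path f (tree_root i) q v ->
  is_path f (i, w) (upward i [::] w ++ q) v.
Proof.
move=> /andP[/= lti vw] pq; elim/last_ind: w vw => //= w a IH vw.
rewrite upward_rcons /= eqxx /tgt /= parent_rcons IH ?(tree_vertex_parent vw) // !andbT.
by apply: edge_contour => //; case: (w).
Qed.

Lemma upward_uniq i w : uniq ((i, w) :: map target (upward i [::] w)).
Proof.
elim/last_ind: w => // w a IH; rewrite upward_rcons map_cons.
have -> : target (Edge i ([::] ++ rcons w a) true) = (i, w).
  by rewrite /target /tgt /= parent_rcons.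
rewrite cons_uniq IH andbT inE negb_or.
apply/andP; split; first by apply/eqP => -[] /(congr1 size); rewrite size_rcons; lia.
by apply/negP => /upward_target[_ /=]; rewrite size_rcons; lia.
Qed.

Lemma upward_self_avoiding i w : is_vertex f (i, w) ->
  self_avoiding f (i, w) (upward i [::] w) (tree_root i).
Proof.
move=> vw; rewrite /self_avoiding upward_uniq andbT -[upward _ _ _]cats0.
by apply: upward_path => //=.
Qed.

Lemma upward_next_self_avoiding i w : is_vertex f (i, w) -> next_tree (size f) i != i ->
  self_avoiding f (i, w) (rcons (upward i [::] w) (Extra i true))
    (tree_root (next_tree (size f) i)).
Proof.
move=> vw ni; have lti : i < size f by case/andP: vw.
rewrite /self_avoiding -cats1 upward_path //=; last first.
  by rewrite extra_contour lti /tgt /= !eqxx.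
rewrite -/target map_cat cats1 mem_rcons rcons_uniq inE negb_or.
have := upward_uniq i w; rewrite cons_uniq => /andP[-> ->]; rewrite !andbT /target /tgt /=.
apply/andP; split; first by apply: contraNneq ni => -[e _]; rewrite -e.
by apply/negP => /upward_target[/= e _]; rewrite e eqxx in ni.
Qed.

End Paths.

Lemma corner_org p i ts w k : (org p (corner i [::] ts w k)) = (i, w).
Proof.
suff H w0 : org p (corner i w0 ts w k) = (i, w0 ++ w) by exact: H.
elim: w w0 ts => [|a w IH] w0 ts /=; last by rewrite IH cat_rcons.
rewrite cats0; case: ifP => _ /=; first by rewrite parent_rcons.
by case: w0.
Qed.

Lemma subforest_vertex ts w k : tree_vertex (Node ts) (rcons w k) =
  tree_vertex (Node ts) w && (k < size (subforest ts w)).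
Proof.
elim: w ts => [|a w IH] ts /=; first by rewrite andbT.
by rewrite -andbA; congr andb; case: (nth _ _ _) => us; rewrite IH.
Qed.

Lemma cornerE i ts w k : corner i [::] ts w k =
  if k < size (subforest ts w) then Edge i (rcons w k) false else close i w.
Proof.
suff H w0 : corner i w0 ts w k =
  if k < size (subforest ts w) then Edge i (w0 ++ rcons w k) false else close i (w0 ++ w).
  exact: H.
elim: w w0 ts => [|a w IH] w0 ts /=; first by rewrite cats1 cats0.
by rewrite IH !cat_rcons.
Qed.

(** The number of the corner [c] among the corners of its vertex. *)
Definition corner_index p f (c : dart) : nat :=
  let v := org p c in
  if c is Edge _ w false then last 0 w
  else size (subforest (children (nth (Node [::]) f v.1)) v.2).

Lemma contour_corner f c : c \in contour f ->
  let v := org (size f) c in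
  let ts := children (nth (Node [::]) f v.1) in
  let k := corner_index (size f) f c in
  [/\ v.1 < size f, tree_vertex (Node ts) v.2, k <= size (subforest ts v.2) &
      c = corner v.1 [::] ts v.2 k].
Proof.
move=> cc v ts k; rewrite cornerE {}/k {}/ts {}/v /corner_index.
case/mem_contour: cc => [[i [w [[] [-> lti w0 vw]]]]|[i lti ->]] /=.
- rewrite ltnn; split=> //; first by case: (nth _ _ _) vw.
  by case: (w) w0.
- case/lastP: w w0 vw => // w k _; rewrite parent_rcons last_rcons.
  case: (nth _ _ _) => ts; rewrite subforest_vertex => /andP[vw ltk] /=.
  by rewrite ltk; split=> //; apply: ltnW.
- by rewrite ltnn; split.
Qed.

(** * Gluing the two parts back *)

Section Glue.
Variables (D : eqType) (r : D -> D) (lm rm : seq D).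
Hypothesis sz : size lm = size rm.

(** In the glued map, the reverse of a half-edge of [lm] is the reverse in the right part of
    the half-edge of [rm] to which it is matched. *)
Lemma glue_reversal_left : uniq lm -> map (glue_reversal r lm rm) lm = map r rm.
Proof.
move=> u; have [d0|] := altP (lm =P [::]).
  by move: sz; rewrite d0 => /eqP; rewrite eq_sym => /nilP ->.
case E: lm => [//|d0 s] _; rewrite -E.
apply: (@eq_from_nth _ d0); rewrite !size_map // => i lti.
rewrite !(nth_map d0) -?sz // /glue_reversal mem_nth // index_uniq //.
by rewrite (set_nth_default d0) // -sz.
Qed.

(** In the glued map, a half-edge of the right part whose reverse is in [rm] is the reverse of
    the matched half-edge of [lm]. *)
Lemma glue_reversal_right ds : uniq rm -> map r ds = rm -> {in ds, forall d, d \notin lm} ->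
  map (glue_reversal r lm rm) ds = lm.
Proof.
move=> u e n.
have szd : size ds = size lm by rewrite sz -e size_map.
have [d0|] := altP (ds =P [::]).
  by move: szd; rewrite d0 => /esym/eqP/nilP ->.
case E: ds => [//|d0 s] _; rewrite -E.
apply: (@eq_from_nth _ d0); rewrite !size_map // => i lti.
have rd : r (nth d0 ds i) = nth d0 rm i by rewrite -e (nth_map d0).
rewrite (nth_map d0) // /glue_reversal (negbTE (n _ _)) ?mem_nth //.
by rewrite rd mem_nth -?sz -?szd // index_uniq -?sz -?szd // (set_nth_default d0) -?szd.
Qed.

Lemma glue_reversal_other d : d \notin lm -> r d \notin rm -> glue_reversal r lm rm d = r d.
Proof. by move=> /negbTE h1 /negbTE h2; rewrite /glue_reversal h1 h2. Qed.
End Glue.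

Lemma mem_map_Old (D : eqType) (d : D) s : (Old d \in map (@Old D) s) = (d \in s).
Proof. by rewrite mem_map // => x y []. Qed.

Lemma mem_map_Copy (D : eqType) (d : D) s : (Copy d \in map (@Copy D) s) = (d \in s).
Proof. by rewrite mem_map // => x y []. Qed.

Lemma Old_inj (D : Type) : injective (@Old D). Proof. by move=> x y []. Qed.
Lemma Copy_inj (D : Type) : injective (@Copy D). Proof. by move=> x y []. Qed.

Lemma map_flipK q : map flip (map flip q) = q.
Proof. by rewrite mapK //; apply: flipK. Qed.

Lemma mem_flip d q : (d \in map flip q) = (flip d \in q).
Proof. by rewrite -(mem_map (inv_inj flipK)) map_flipK. Qed.

Lemma flabels_cons f i : i < size f ->
  exists ls, flabels i f = i :: ls.
Proof.
move=> lti; rewrite /flabels /rot (drop_nth 0) ?size_iota // nth_iota // add0n.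
by eexists.
Qed.

Lemma flabels_cons2 f i : i < size f -> 1 < size f ->
  exists ls, flabels i f = i :: next_tree (size f) i :: ls.
Proof.
move=> lti lt1; rewrite /flabels /rot (drop_nth 0) ?size_iota // nth_iota // add0n /next_tree.
have [lei|] := ltnP i.+1 (size f).
  rewrite (drop_nth 0) ?size_iota // nth_iota // add0n modn_small //.
  by eexists.
move=> le; have e : size f = i.+1 by lia.
rewrite drop_oversize ?size_iota // e modnn /=.
by case: i lti le e => [|i] lti le e; [lia | eexists].
Qed.

Lemma flabels_uniq f i : uniq (flabels i f).
Proof. by rewrite rot_uniq iota_uniq. Qed.

Lemma mem_flabels f i l : l \in flabels i f = (l < size f).
Proof. by rewrite mem_rot mem_iota. Qed.

Lemma size_flabels f i : size (flabels i f) = size f.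
Proof. by rewrite size_rot size_iota. Qed.

(** * The map obtained by adding a tree *)

(** The reversal of the half-edges away from the cut. *)
Definition Old_flip (x : label dart) : label dart := cut_reversal flip [::] x.

(** Cutting, shifting by one step and gluing inserts the closing letter [Stub true] in the
    contour, at the corner. *)
Lemma map_up_represents f j ts F w k m T1 T2 : j < size f -> rot j f = Node ts :: F ->
  graft w k m ts T1 T2 ->
  exists s1 s2 es, size s1 = m /\
    represents (map_up f (corner j [::] ts w k) j (upward j [::] w))
      (Node T1 :: Node T2 :: F) (s1 ++ Stub true :: s2) es.
Proof.
move=> ltj fE gr.
have [ls lsE] := flabels_cons ltj.
have sz : size ls = size F.
  have := size_flabels f j; rewrite lsE /= -(size_rot j f) fE /=; lia.
have rE : rcontour j f = kids j [::] 0 ts ++ Extra j true :: fcontour ls F.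
  by rewrite /rcontour lsE fE fcontour_cons.
have [s1 [s2 [X [Y [sd [sp kE s1m hd]]]]]] :=
  @graft_splice_up _ Old_flip (@Old dart) (fun d => erefl) _ _ _ _ _ _ j [::] (Stub true) gr.
set q := upward j [::] w in sp *; set R := fcontour ls F in rE.
pose c := corner j [::] ts w k.
have ur := rcontour_uniq j f; rewrite rE kE in ur.
have cE : exists b, s2 ++ Extra j true :: R = c :: b.
  by move: hd; rewrite -/c; case: (s2) => [|d s] /= <-; eexists.
have [b bE] := cE.
have co := cyc_rcontour j f; rewrite rE kE -catA bE in co.
have saE := cyc_rot_index (contour_uniq f) co.
have pm : perm_eq (s1 ++ s2) (sd ++ map flip q ++ q).
  by have := splice_perm sp; rewrite -!map_cat; apply: perm_map_inj; apply: Old_inj.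
have u12 : uniq (s1 ++ s2) by move: ur; rewrite cat_uniq => /and3P[].
(* The climbing half-edges, the descending ones and the others are pairwise distinct. *)
have [uq qf sdq] : [/\ uniq q, {in q, forall d, flip d \notin q} &
    {in sd, forall d, d \notin q /\ flip d \notin q}].
  move: u12; rewrite (perm_uniq pm) catA cat_uniq cat_uniq => /and3P[/and3P[_ h1 _] h2 ->].
  split=> // d dq.
    by apply: contra (hasPn h2 d dq) => /=; rewrite mem_cat mem_flip => ->; rewrite orbT.
  split; first by apply: contraL dq => /(hasPn h2); rewrite /= mem_cat negb_or => /andP[].
  by apply: contraL dq => h; apply: (hasPn h1); rewrite mem_flip.
have q12 : {subset q <= s1 ++ s2}.
  by move=> d dq; rewrite (perm_mem pm) !mem_cat dq !orbT.
have fq12 d : flip d \in q -> d \in s1 ++ s2.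
  by move=> dq; rewrite (perm_mem pm) !mem_cat mem_flip dq !orbT.
have Rq : {in R, forall d, d \notin q /\ flip d \notin q}.
  move=> d dR; have dn : d \notin s1 ++ s2.
    move: ur; rewrite cat_uniq => /and3P[_ /hasPn h _]; apply: h.
    by rewrite inE dR orbT.
  by split; [apply: contra dn; exact: q12 | apply: contra dn; exact: fq12].
have xl l b' : Extra l b' \notin q.
  by apply/negP => /q12; rewrite -kE => /mem_kids[? [? [? []]]].
set M := map_up _ _ _ _.
set r := cut_reversal flip q.
pose lm := Stub true :: map (@Old dart) q.
pose rm := rcons (map (@Copy dart) q) (Link true).
pose r' := glue_reversal r lm rm.
have szlr : size lm = size rm by rewrite /= size_rcons !size_map.
have revM : rev_of M = r'.
  by rewrite /M /map_up /= take_oversize // size_rcons !size_map.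
have ulm : uniq lm.
  rewrite /= map_inj_uniq ?uq ?andbT //; last exact: Old_inj.
  by apply/mapP => -[].
have urm : uniq rm.
  rewrite rcons_uniq map_inj_uniq ?uq ?andbT //; last exact: Copy_inj.
  by apply/mapP => -[].
have r'Old d : d \notin q -> flip d \notin q -> r' (Old d) = Old (flip d).
  move=> h1 h2; have rd : r (Old d) = Old (flip d) by rewrite /r /= (negbTE h1) (negbTE h2).
  rewrite /r' glue_reversal_other ?rd //.
    by rewrite inE /= mem_map_Old.
  by rewrite mem_rcons inE /=; apply/mapP => -[].
have mem_lm d : (Old d \in lm) = (d \in q) by rewrite inE /= mem_map_Old.
(* The shift by one step: the reversal exchanges the descending half-edges with those of
   [Stub true :: q], except that [Link false], in the inner face, is exchanged with the
   last one. *)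
have /rcons_inj[r'b r'l] :
    rcons (map r' (belast (Stub true) (map (@Old _) q))) (r' (last (Stub true) (map (@Old _) q)))
    = rcons (map (@Old _) (map flip q)) (Link false).
  rewrite -map_rcons -lastI (glue_reversal_left r szlr ulm).
  by rewrite /rm map_rcons -!map_comp.
have /rcons_inj[r'f r'k] : rcons (map r' (map (@Old _) (map flip q))) (r' (Link false)) =
    rcons (belast (Stub true) (map (@Old _) q)) (last (Stub true) (map (@Old _) q)).
  rewrite -lastI -map_rcons; apply: glue_reversal_right => //.
    rewrite map_rcons /rm; congr rcons; rewrite -!map_comp.
    by apply/eq_in_map => d dq; rewrite /r /= flipK dq orbT.
  move=> x; rewrite mem_rcons inE => /orP[/eqP->|].
    by rewrite inE /=; apply/mapP => -[].
  by rewrite -map_comp => /mapP[d dq ->]; rewrite /= mem_lm qf.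
have sdr : {in map (@Old _) sd, Old_flip =1 r'}.
  by move=> _ /mapP[d /sdq[h1 h2] ->]; rewrite r'Old.
have [cT1 cT2] := splice_new sp sdr r'f r'b.
have catE := splice_cat sp.
set z' := last _ _ in r'l r'k catE.
pose s2' := map (@Old _) (s2 ++ Extra j true :: R).
have sE : map (@Old _) s1 ++ Stub true :: s2' =
    X ++ z' :: Y ++ Old (Extra j true) :: map (@Old _) R.
  by rewrite /s2' map_cat /= -cat_cons catA catE -catA.
have xr l b' : r' (Old (Extra l b')) = Old (Extra l (~~ b')) by rewrite r'Old /= ?xl.
exists (map (@Old _) s1), s2', (z' :: map (@Old _) [seq Extra l true | l <- j :: ls]).
split; first by rewrite size_map.
have esE : [seq r' d | d <- z' :: map (@Old _) [seq Extra l true | l <- j :: ls]] =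
    Link false :: map (@Old _) [seq Extra l false | l <- j :: ls].
  by rewrite /= r'l xr -!map_comp; congr (_ :: _ :: _); apply/eq_map => l /=; rewrite xr.
rewrite /represents revM esE; split.
- rewrite sE; apply: fcodes_cons => //; apply: fcodes_cons => //.
  apply: (fcodes_map (fcodes_fcontour sz)) => d /Rq[h1 h2].
  by rewrite r'Old.
- do 2!eexists; split; first by reflexivity.
    rewrite /= drop_oversize /= ?size_rcons ?size_map // cats0 -map_cat cat_take_drop saE.
    rewrite -[c :: b ++ s1]cat_cons -bE map_cat.
    exact: cyc_catC.
  have nj : j \notin ls by have := flabels_uniq f j; rewrite lsE => /andP[].
  set G := fun d : label dart => _.
  have -> : rev (Link false :: map (@Old _) [seq Extra l false | l <- j :: ls]) =
      flatten (map G (map (@Old _) [seq Extra l false | l <- rev (j :: ls)])).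
    rewrite /= !rev_cons !map_rcons flatten_rcons /G eqxx -!cats1 -catA; congr (_ ++ _).
    rewrite -!map_rev -!map_comp -[LHS]flatten_seq1 -map_comp; congr flatten.
    apply/eq_in_map => l; rewrite mem_rev => lls /=; rewrite ifN //.
    by apply: contra nj => /eqP[<-].
  apply/cyc_flatten/cyc_map/cyc_map/cyc_map/cyc_rev/cyc_sym.
  by rewrite -lsE; exists j.
- pose u := Stub true :: Link false :: map (@Old _) ((s1 ++ s2 ++ Extra j true :: R)
      ++ [seq Extra l false | l <- j :: ls]).
  have /perm_uniq -> : perm_eq ((map (@Old _) s1 ++ Stub true :: s2') ++
      Link false :: map (@Old _) [seq Extra l false | l <- j :: ls]) u.
    by apply/permP => P; rewrite /u /s2' !(map_cat, count_cat) /= !(map_cat, count_cat) /=; lia.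
  rewrite /u !cons_uniq map_inj_uniq; last exact: Old_inj.
  rewrite inE /=; apply/and3P; split; try by apply/mapP => -[].
  have rE' : s1 ++ s2 ++ Extra j true :: R = rcontour j f by rewrite rE kE -catA.
  rewrite -[_ :: map _ ls]/([seq Extra l false | l <- j :: ls]) -lsE rE'.
  rewrite cat_uniq rcontour_uniq map_inj_uniq ?flabels_uniq ?andbT //; last by move=> ? ? [].
  apply/hasPn => _ /mapP[l _ ->]; rewrite /= (cyc_mem (cyc_rcontour j f)).
  by rewrite extra_contour.
- move=> x; rewrite inE => /orP[/eqP->|]; first by rewrite r'l r'k.
  by move=> /mapP[_ /mapP[l _ ->] ->]; rewrite !xr.
Qed.

(** * The map obtained by removing a tree *)

(** Cutting, shifting by one step backwards and gluing removes from the contour the closing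
    letter [h] of the distinguished vertex; the corner is where this letter was. *)
Lemma map_down_represents f i h q T1 T2 ts F w k m : i < size f -> 1 < size f ->
  rot i f = Node T1 :: Node T2 :: F -> graft w k m ts T1 T2 ->
  h :: q = rcons (upward i [::] w) (Extra i true) ->
  exists s1 s2 es, size s1 = m /\
    represents (map_down f i h q) (Node ts :: F) (s1 ++ corner_down f i h q :: s2) es.
Proof.
move=> lti lt1 fE gr hq.
have [ls lsE] := flabels_cons2 lti lt1.
set i' := next_tree (size f) i in lsE.
have sz : size ls = size F.
  have := size_flabels f i; rewrite lsE /= -(size_rot i f) fE /=; lia.
set R := fcontour ls F.
set Y := kids i' [::] 0 T2.
have rE : rcontour i f = kids i [::] 0 T1 ++ Extra i true :: Y ++ Extra i' true :: R.
  by rewrite /rcontour lsE fE !fcontour_cons.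
have cY : codes Old_flip T2 (map (@Old dart) Y) by apply: codes_map_kids.
have [s1 [s2 [sd [sp hE s1m]]]] :=
  @graft_splice_down _ Old_flip (@Old dart) (fun d => erefl) _ _ _ _ _ _ i [::] _ h q gr cY hq.
have [bq lq] : belast h q = upward i [::] w /\ last h q = Extra i true.
  by move: hq; rewrite lastI => /rcons_inj[].
rewrite -bq in sp.
have catE := splice_cat sp.
rewrite last_map lq in catE.
have kE : s1 ++ h :: s2 = kids i [::] 0 T1 ++ Extra i true :: Y.
  by apply: (inj_map (@Old_inj dart)); rewrite !map_cat.
have {}rE : rcontour i f = s1 ++ h :: s2 ++ Extra i' true :: R.
  by rewrite rE -cat_cons catA -kE -catA.
have ur := rcontour_uniq i f; rewrite rE in ur.
have co := cyc_rcontour i f; rewrite rE in co.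
have saE := cyc_rot_index (contour_uniq f) co.
have pm : perm_eq (s1 ++ s2) (sd ++ map flip (belast h q) ++ q).
  by have := splice_perm sp; rewrite -!map_cat; apply: perm_map_inj; apply: Old_inj.
have u12 : uniq (h :: s1 ++ s2).
  have : uniq (s1 ++ h :: s2) by move: ur; rewrite -cat_cons catA cat_uniq => /and3P[].
  by rewrite -[h :: s2]cat1s uniq_catCA.
have hn : h \notin s1 ++ s2 by case/andP: u12.
have extra_i l : Extra l false \notin contour f by rewrite extra_contour.
have co_mem d : d \in s1 ++ h :: s2 ++ Extra i' true :: R -> d \in contour f.
  by rewrite (cyc_mem co).
(* The climbing half-edges, the descending ones and the others are pairwise distinct. *)
have uall : uniq (h :: sd ++ map flip (belast h q) ++ q).
  by rewrite cons_uniq -(perm_uniq pm) -(perm_mem pm) -cons_uniq.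
have hqE : h :: q = rcons (belast h q) (Extra i true) by rewrite lastI lq.
have flip_notin d : d \in contour f -> d \notin map flip (belast h q) -> flip d \notin h :: q.
  move=> dc db; rewrite hqE mem_rcons inE negb_or -mem_flip db andbT.
  by apply: contraL dc => /eqP/(congr1 flip); rewrite flipK => ->; exact: extra_i.
have in12 d : d \in s1 ++ s2 -> d \in contour f.
  move=> d12; apply: co_mem; rewrite -cat_cons catA mem_cat; apply/orP; left.
  by move: d12; rewrite !mem_cat inE => /orP[->|->]; rewrite ?orbT.
have uq : uniq (h :: q).
  move: uall; rewrite /= mem_cat negb_or mem_cat negb_or => /andP[/andP[_ /andP[_ ->]]].
  by rewrite !cat_uniq => /and3P[_ _ /and3P[_ _ ->]].
have [hB hsd Bq sdB sdnq] : [/\ h \notin map flip (belast h q), h \notin sd,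
    {in q, forall d, d \notin map flip (belast h q)},
    {in sd, forall d, d \notin map flip (belast h q)} & {in sd, forall d, d \notin q}].
  move: uall; rewrite cons_uniq !mem_cat !negb_or => /andP[/and3P[h1 h2 _]].
  rewrite !cat_uniq => /and3P[_ /hasPn h3 /and3P[_ /hasPn h4 _]]; split=> // d dd.
  - by apply: contraL dd => db; apply: (h3); rewrite mem_cat db.
  - by apply: contraL dd => db; apply: (h3); rewrite mem_cat db orbT.
have qf : {in belast h q, forall d, flip d \notin h :: q}.
  move=> d db; have fd : flip d \in map flip (belast h q) by rewrite map_f.
  rewrite inE negb_or; apply/andP; split; first by apply: contraNneq hB => dh; rewrite -{1}dh.
  by apply: contraL fd => /Bq.
have sdq : {in sd, forall d, d \notin h :: q /\ flip d \notin h :: q}.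
  move=> d ds; split.
    by rewrite inE negb_or sdnq // andbT; apply: contraNneq hsd => <-.
  by apply: flip_notin (sdB d ds); apply: in12; rewrite (perm_mem pm) mem_cat ds.
have q12 d : d \in q -> d \in s1 ++ s2.
  by move=> dq; rewrite (perm_mem pm) !mem_cat dq !orbT.
have Rq : {in Extra i' true :: R, forall d, d \notin h :: q /\ flip d \notin h :: q}.
  move=> d dR; have dn : d \notin h :: s1 ++ s2.
    have : d \notin s1 ++ h :: s2.
      by move: ur; rewrite -cat_cons catA cat_uniq => /and3P[_ /hasPn h1 _]; apply: h1.
    by rewrite !(mem_cat, inE) !negb_or => /and3P[-> -> ->].
  split; first by apply: contra dn; rewrite !inE => /orP[->//|/q12->]; rewrite orbT.
  apply: flip_notin; first by apply: co_mem; rewrite mem_cat inE mem_cat dR !orbT.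
  apply: contra dn => dB; rewrite inE (perm_mem pm) mem_cat; apply/orP; right.
  by rewrite mem_cat dB orbT.
set M := map_down _ _ _ _.
set r := cut_reversal flip (h :: q).
pose lm := map (@Old dart) q.
pose rm := map (@Copy dart) (belast h q).
pose r' := glue_reversal r lm rm.
have szlr : size lm = size rm by rewrite !size_map size_belast.
have tq : take (size q) (h :: q) = belast h q.
  by rewrite lastI -cats1 take_size_cat // size_belast.
have revM : rev_of M = r'.
  rewrite /M /map_down /delete_edges /glue /= drop0 size_map.
  by rewrite -(map_cons (@Copy dart) h q) -map_take tq.
have ulm : uniq lm.
  by rewrite map_inj_uniq; [case/andP: uq|apply: Old_inj].
have ub : uniq (belast h q) by move: uq; rewrite lastI rcons_uniq => /andP[].
have urm : uniq rm.
  by rewrite map_inj_uniq //; apply: Copy_inj.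
have r'Old d : d \notin h :: q -> flip d \notin h :: q -> r' (Old d) = Old (flip d).
  move=> h1 h2; have rd : r (Old d) = Old (flip d) by rewrite /r /= (negbTE h1) (negbTE h2).
  rewrite /r' glue_reversal_other ?rd //.
    by rewrite mem_map_Old; apply: contra h1; rewrite inE => ->; rewrite orbT.
  by apply/mapP => -[].
(* The shift by one step: the half-edges of [q] are now matched with the descending ones,
   which were matched with those of [h :: q] but the last. *)
have r'b : map r' (map (@Old _) q) = map (@Old _) (map flip (belast h q)).
  by rewrite (glue_reversal_left r szlr ulm) -!map_comp.
have r'f : map r' (map (@Old _) (map flip (belast h q))) = map (@Old _) q.
  apply: glue_reversal_right => //.
    rewrite -!map_comp; apply/eq_in_map => d db; rewrite /r /= flipK.
    by rewrite hqE !mem_rcons !inE db !orbT.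
  rewrite -map_comp => _ /mapP[d db ->]; rewrite mem_map_Old.
  by apply: contra (qf d db); rewrite inE => ->; rewrite orbT.
have sdr : {in map (@Old _) sd, Old_flip =1 r'}.
  by move=> _ /mapP[d /sdq[h1 h2] ->]; rewrite r'Old.
have cts := splice_old sp sdr r'f r'b.
have xls l b' : l \in i' :: ls -> Extra l b' \notin h :: q.
  move=> ll; have lR : Extra l true \in Extra i' true :: R.
    move: ll; rewrite !inE => /orP[/eqP->|ll]; first by rewrite eqxx.
    by rewrite (fcodes_sub (fcodes_fcontour sz)) ?orbT // map_f.
  case: b'; first by case: (Rq _ lR).
  apply: contra (extra_i l); rewrite inE => /orP[/eqP->|/q12/in12 //].
  by apply: co_mem; rewrite mem_cat mem_head orbT.
have xr l b' : l \in i' :: ls -> r' (Old (Extra l b')) = Old (Extra l (~~ b')).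
  by move=> lf; rewrite r'Old ?xls.
have [b [c bE]] : exists b c, s2 ++ Extra i' true :: R = c :: b.
  by case: (s2) => [|d s]; do 2!eexists.
(* The deletions remove the dangling [Old h], of reverse [Copy (flip h)], and the extra
   edge [Copy (Extra i true)], of reverse [Old (Extra i false)], and nothing else. *)
have facesM : faces M = [:: map (@Old _) (c :: b ++ s1);
    [seq Old (Extra l false) | l <- rev (iota 0 (size f)) & l != i]].
  have delE d : d \in s1 ++ s2 ++ Extra i' true :: R -> exists2 d', r' (Old d) = Old d' & d' != h.
    have oldE d0 : d0 \notin h :: q /\ flip d0 \notin h :: q ->
        exists2 d', r' (Old d0) = Old d' & d' != h.
      move=> [h1 h2]; exists (flip d0); first exact: r'Old.
      by apply: contra h2 => /eqP->; rewrite mem_head.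
    rewrite catA mem_cat (perm_mem pm) !mem_cat -!orbA => /or4P[/sdq/oldE//|dB|dq|/Rq/oldE//].
    - have : r' (Old d) \in map (@Old _) q by rewrite -r'f !map_f.
      move=> /mapP[d' dq' ->]; exists d' => //.
      by apply: contraNneq hn => <-; apply: q12.
    - have : r' (Old d) \in map (@Old _) (map flip (belast h q)) by rewrite -r'b !map_f.
      by move=> /mapP[d' dq' ->]; exists d' => //; apply: contraNneq hB => dh; rewrite -{1}dh.
  pose del := [pred x | (x \in [:: Old h; Copy (last h q)])
    || (r' x \in [:: Old h; Copy (last h q)])].
  have hall : h \notin s1 ++ s2 ++ Extra i' true :: R.
    by move: ur; rewrite -[h :: s2 ++ _]cat1s uniq_catCA cons_uniq => /andP[].
  have keep s : {subset s <= s1 ++ s2 ++ Extra i' true :: R} ->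
      [seq x <- map (@Old _) s | ~~ del x] = map (@Old _) s.
    move=> sub; apply/all_filterP/allP => _ /mapP[d ds ->].
    have [d' r'd d'h] := delE d (sub d ds).
    rewrite /= r'd !inE /= !orbF negb_or; apply/andP; split; last by apply: contra d'h => /eqP[->].
    by apply: contraNneq hall => -[<-]; apply: sub.
  have delh : r' (Copy (flip h)) = Old h.
    rewrite /r' glue_reversal_other /= ?flipK //; by apply/mapP => -[].
  have delx : r' (Old (Extra i false)) = Copy (last h q).
    have iq : Extra i true \in h :: q by rewrite hqE mem_rcons mem_head.
    have rd : r (Old (Extra i false)) = Copy (Extra i true) by rewrite /r /= iq orbT.
    rewrite /r' glue_reversal_other ?rd ?lq //.
      rewrite mem_map_Old; apply: contra (extra_i i) => /q12; exact: in12.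
    by rewrite mem_map_Copy; move: uq; rewrite hqE rcons_uniq => /andP[].
  have glueE : faces (glue 1 (cut (forest_map f) h (Extra i' true) (h :: q))) =
    [:: Old h :: map (@Old _) s2 ++ Copy (last h q) :: map (@Old _) (Extra i' true :: R ++ s1)
          ++ [:: Copy (flip h)];
        map (@Old _) [seq Extra l false | l <- rev (iota 0 (size f))]].
    rewrite /= drop0 size_map saE.
    have -> : index (Extra i' true) (h :: (s2 ++ Extra i' true :: R) ++ s1) = size (h :: s2).
      have ni : Extra i' true \notin h :: s2.
        move: ur; rewrite -cat_cons catA cat_uniq => /and3P[_ /hasPn ni _].
        move: (ni (Extra i' true) (mem_head _ _)).
        by rewrite /= mem_cat negb_or => /andP[].
      by rewrite -catA -cat_cons index_cat (negbTE ni) /= eqxx addn0.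
    rewrite -catA -cat_cons take_size_cat // drop_size_cat //=.
    have dq : drop (size q) (h :: q) = [:: last h q].
      by rewrite lastI -cats1 drop_size_cat // size_belast.
    rewrite -(map_cons (@Copy _) h q) -map_drop dq take0.
    by rewrite /Defs.rev_path /= inE eqxx.
  have -> : faces M = [seq [seq d <- g | ~~ del d]
      | g <- faces (glue 1 (cut (forest_map f) h (Extra i' true) (h :: q)))].
    by rewrite /del -revM.
  have keepl l : l < size f -> del (Old (Extra l false)) = (l == i).
    move=> ltl; have [->|nli] := eqVneq l i; first by rewrite /= delx !inE eqxx !orbT.
    have ll : l \in i' :: ls.
      by have := mem_flabels f i l; rewrite lsE ltl inE (negbTE nli).
    have lh : Old (Extra l (~~ false)) != Old h.
      by apply: contra (xls l true ll) => /eqP[->]; rewrite mem_head.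
    have lh' : Old (Extra l false) != Old h.
      by apply: contra (xls l false ll) => /eqP[->]; rewrite mem_head.
    by rewrite /= xr // !inE (negbTE lh) (negbTE lh').
  have [dh dl df] : [/\ del (Old h), del (Copy (last h q)) & del (Copy (flip h))].
    by rewrite /= delh !inE !eqxx !orbT.
  rewrite glueE {glueE}; clearbody del.
  have drop1 x s : del x -> [seq d <- x :: s | ~~ del d] = [seq d <- s | ~~ del d].
    by move=> /= ->.
  have map2 (T U : Type) (g : T -> U) x y : map g [:: x; y] = [:: g x; g y] by [].
  rewrite map2 (drop1 (Old h)) // filter_cat (drop1 (Copy (last h q))) //.
  rewrite filter_cat (drop1 (Copy (flip h))) //.
  have sub1 : {subset s2 <= s1 ++ s2 ++ Extra i' true :: R}.
    by move=> d; rewrite !mem_cat => ->; rewrite orbT.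
  have sub2 : {subset Extra i' true :: R ++ s1 <= s1 ++ s2 ++ Extra i' true :: R}.
    by move=> d; rewrite -cat_cons !mem_cat => /orP[->|->]; rewrite ?orbT.
  rewrite (keep _ sub1) (keep _ sub2).
  rewrite cats0 -map_cat -cat_cons catA bE -map_comp filter_map /=; congr [:: _; _ ].
  congr map; apply: eq_in_filter => l.
  by rewrite mem_rev mem_iota => /= ltl; rewrite keepl.
have -> : corner_down f i h q = Old c by rewrite /corner_down -/M facesM.
exists (map (@Old _) s1), (map (@Old _) b), (map (@Old _) [seq Extra l true | l <- i' :: ls]).
split; first by rewrite size_map.
have esE : [seq r' d | d <- map (@Old _) [seq Extra l true | l <- i' :: ls]] =
    map (@Old _) [seq Extra l false | l <- i' :: ls].
  by rewrite -!map_comp; apply/eq_in_map => l lf /=; rewrite xr.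
rewrite -[Old c :: _]/(map (@Old _) (c :: b)) -bE.
rewrite /represents revM esE; split.
- rewrite map_cat catA; apply: fcodes_cons => //.
  apply: (fcodes_map (fcodes_fcontour sz)) => d dR.
  by have [h1 h2] := Rq d (mem_behead (s := _ :: _) dR); rewrite r'Old.
- do 2!eexists; split; first by rewrite facesM.
    by rewrite bE -map_cat; apply/cyc_map; rewrite -cat_cons; apply: cyc_catC.
  rewrite -!map_rev -map_comp; apply/cyc_map.
  have -> : rev (i' :: ls) = [seq l <- rev (i :: i' :: ls) | l != i].
    rewrite [in RHS]rev_cons filter_rcons eqxx; apply/esym/all_filterP/allP => l.
    rewrite mem_rev => ll; have := flabels_uniq f i; rewrite lsE cons_uniq => /andP[+ _].
    by apply: contra => /eqP <-.
  by apply/cyc_filter/cyc_rev/cyc_sym; rewrite -lsE; exists i.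
- rewrite -!map_cat map_inj_uniq; last exact: Old_inj.
  have := ur; rewrite -[h :: s2 ++ _]cat1s uniq_catCA cat1s cons_uniq => /andP[_ us].
  rewrite cat_uniq us map_inj_uniq; last by move=> ? ? [].
  have := flabels_uniq f i; rewrite lsE cons_uniq => /andP[_ ->]; rewrite andbT.
  apply/hasPn => _ /mapP[l _ ->] /=; apply: contra (extra_i l) => ll; apply: co_mem.
  by move: ll; rewrite !(mem_cat, inE) => /orP[->//|->]; rewrite !orbT.
- by move=> _ /mapP[_ /mapP[l ll ->] ->]; rewrite !xr.
Qed.

(** * The two mappings are inverse bijections *)

Lemma close_org p i w : org p (close i w) = (i, w).
Proof. by case: w. Qed.

(** The closing letter of the grafted vertex occurs at the position recorded by the graft. *)
Lemma rcontour_vertex f i w k m ts T1 T2 F : i < size f -> 1 < size f ->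
  rot i f = Node T1 :: Node T2 :: F -> graft w k m ts T1 T2 ->
  exists t1 t2, rcontour i f = t1 ++ close i w :: t2 /\ size t1 = m.
Proof.
move=> lti lt1 fE gr; have [ls lsE] := flabels_cons2 lti lt1.
have [h [q hq]] : exists h q, h :: q = rcons (upward i [::] w) (close i [::]).
  by case: (upward _ _ _) => [|h q]; do 2!eexists.
have [s1 [s2 [sd [sp hE <-]]]] := graft_splice_down (r := flip) (g := id)
  (fun d => erefl) gr
  (codes_map_kids (r := flip) (g := id) (fun d => erefl) (next_tree (size f) i) [::] 0 T2)
  hq.
have := splice_cat sp; rewrite !map_id => e.
have lq : last h q = Extra i true by rewrite -[last h q]/(last h (h :: q)) hq last_rcons.
exists s1, (s2 ++ Extra (next_tree (size f) i) true :: fcontour ls F); split=> //.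
have -> t : s1 ++ close i w :: s2 ++ t = (s1 ++ h :: s2) ++ t by rewrite -catA hE.
by rewrite /rcontour lsE fE !fcontour_cons e lq -catA.
Qed.

(** The corner occurs at the position recorded by the graft. *)
Lemma rcontour_corner f j w k m ts T1 T2 F : j < size f ->
  rot j f = Node ts :: F -> graft w k m ts T1 T2 ->
  exists s1 s2, rcontour j f = s1 ++ corner j [::] ts w k :: s2 /\ size s1 = m.
Proof.
move=> ltj fE gr; have [ls lsE] := flabels_cons ltj.
have [s1 [s2 [_ [_ [_ [_ e <- hd]]]]]] :=
  graft_splice_up (r := flip) (g := id) (fun d => erefl) j [::] (Extra j true) gr.
exists s1; rewrite /rcontour lsE fE !fcontour_cons e -catA -hd.
by case: (s2) => [|d s]; eexists.
Qed.

Lemma corner_contour f j w k m ts T1 T2 F : j < size f ->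
  rot j f = Node ts :: F -> graft w k m ts T1 T2 ->
  corner j [::] ts w k \in contour f.
Proof.
move=> ltj fE gr; have [s1 [s2 [e _]]] := rcontour_corner ltj fE gr.
by rewrite -(cyc_mem (cyc_rcontour j f)) e mem_cat mem_head orbT.
Qed.

Lemma map_split (T U : Type) (g : T -> U) s1 x s2 t1 y t2 :
  size s1 = size t1 -> map g (s1 ++ x :: s2) = t1 ++ y :: t2 -> g x = y.
Proof. by move=> sz; rewrite map_cat => /eq_cat2[]; rewrite ?size_map // => _ []. Qed.

Lemma rot_nth (T : Type) (x0 : T) i s a b : i < size s -> rot i s = a :: b -> nth x0 s i = a.
Proof. by move=> lti; rewrite /rot (drop_nth x0) //= => -[]. Qed.

Lemma rot_nthE (T : Type) (x0 : T) i s : i < size s -> rot i s = nth x0 s i :: behead (rot i s).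
Proof. by move=> lti; rewrite /rot (drop_nth x0). Qed.

Lemma next_tree_neq p i : 0 < p -> i < p.+1 -> next_tree p.+1 i != i.
Proof.
move=> p0 lti; rewrite /next_tree; have [lt|le] := ltnP i.+1 p.+1.
  by rewrite modn_small //; lia.
have -> : i = p by lia.
by rewrite modnn; lia.
Qed.

Lemma forest_inj n p (f g : forest n p) : trees f = trees g :> seq tree -> f = g.
Proof.
case: f g => [f fP] [g gP] /= /val_inj e; rewrite e in fP *.
by rewrite (eq_irrelevance fP gP).
Qed.

Lemma forest_ci_inj n p (x y : forest_ci n p) :
  trees x = trees y :> seq tree -> ci_corner x = ci_corner y ->
  ci_index x = ci_index y :> nat -> x = y.
Proof.
case: x y => [f c i fP] [g d j gP] /= /forest_inj e1 e2 /val_inj e3; subst.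
by rewrite (eq_irrelevance fP gP).
Qed.

Lemma forest_vi_inj n p (x y : forest_vi n p) :
  trees x = trees y :> seq tree -> vi_vertex x = vi_vertex y ->
  vi_index x = vi_index y :> nat -> x = y.
Proof.
case: x y => [f c i fP] [g d j gP] /= /forest_inj e1 e2 /val_inj e3; subst.
by rewrite (eq_irrelevance fP gP).
Qed.

(** Both mappings are given by this relation: once the forests are re-rooted at the tree of
    the distinguished corner, resp. vertex, the first tree of [x] is replaced by the first
    two trees of [y] by a graft. *)
Definition grafted n p (x : forest_ci n p) (y : forest_vi n p) : Prop :=
  exists ts F T1 T2 w k m,
  [/\ graft w k m ts T1 T2,
      rot (vi_index y) (trees x) = Node ts :: F,
      rot (ci_index x) (trees y) = Node T1 :: Node T2 :: F,
      ci_corner x = corner (vi_index y) [::] ts w k &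
      vi_vertex y = (nat_of_ord (ci_index x), w)].

Lemma sumn_cons a s : sumn (a :: s) = a + sumn s.
Proof. by []. Qed.

Lemma sumn_rotr_edges i f :
  sumn [seq tree_edges t | t <- rotr i f] = sumn [seq tree_edges t | t <- f].
Proof. by rewrite map_rotr; apply/perm_sumn/permPl/perm_rotr. Qed.

Lemma grafted_up n p (x : forest_ci n p) : {y | grafted x y}.
Proof.
case: x => f c i cP; have szx : size (trees f) = p by rewrite size_tuple.
have [ltj vw lek cE] := contour_corner cP.
move: ltj vw lek cE; rewrite szx.
set j := (org p c).1; set w := (org p c).2; set k := corner_index p f c.
set ts := children _ => ltj vw lek cE.
set T := graft_up ts w k.
have szf : j < size (trees f) by rewrite szx.
have fE := rot_nthE (Node [::]) szf.
have {}fE : rot j (trees f) = Node ts :: behead (rot j (trees f)).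
  by rewrite {1}fE /ts; case: (nth _ _ _).
set F := behead _ in fE.
pose g := rotr i (Node T.1 :: Node T.2 :: F).
have szg : size g == p.+1.
  by rewrite size_rotr /=; have := size_rot j (trees f); rewrite fE szx /= => ->.
have exg := graft_upP vw lek.
have edg : sumn [seq tree_edges t | t <- g] == n.
  case: (f) fE => f' /= /eqP <- fE; rewrite sumn_rotr_edges map_cons sumn_cons map_cons sumn_cons.
  have [m gr] := exg.
  by rewrite -(rotK j f') fE sumn_rotr_edges map_cons sumn_cons (graft_edges gr) addnA.
have lti : i < size g by rewrite (eqP szg).
have rg : rot i g = Node T.1 :: Node T.2 :: F by rewrite rotrK.
have vg : is_vertex (Tuple szg) (nat_of_ord i, w).
  by have [m gr] := exg; rewrite /is_vertex /= lti (rot_nth _ lti rg) (graft_vertex gr).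
exists (@ForestVI n p (@Forest n p.+1 (Tuple szg) edg) (nat_of_ord i, w) (Ordinal ltj) vg).
by have [m gr] := exg; exists ts, F, T.1, T.2, w, k, m.
Qed.

Lemma grafted_down n p (y : forest_vi n p) : 0 < p -> {x | grafted x y}.
Proof.
case: y => f [i w] j vP p0; have szy : size (trees f) = p.+1 by rewrite size_tuple.
have /andP[/= lti vw] := vP.
have fE := rot_nthE (Node [::]) lti.
have lti' : i < p.+1 by rewrite -szy.
have szr := size_rot i (trees f); rewrite fE szy in szr.
have {}fE : rot i (trees f) = Node (children (nth (Node [::]) f i))
   :: Node (children (head (Node [::]) (behead (rot i f)))) :: behead (behead (rot i f)).
  rewrite {1}fE; case: (nth _ _ _) => us; congr cons.
  by case: (behead _) szr => [|[vs] F'] //= -[e]; rewrite -e in p0.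
set T1 := children _ in fE; set T2 := children _ in fE; set F := behead _ in fE.
have {}vw : tree_vertex (Node T1) w by rewrite /T1; case: (nth _ _ _) vw.
pose T := graft_down T1 w T2.
pose g := rotr j (Node T.1 :: F).
have szg : size g == p.
  by rewrite size_rotr /=; have := size_rot i (trees f); rewrite fE szy /= => -[->].
have exg := graft_downP T2 vw.
have edg : sumn [seq tree_edges t | t <- g] == n.
  case: (f) fE => f' /= /eqP <- fE; have [m gr] := exg.
  rewrite sumn_rotr_edges map_cons sumn_cons (graft_edges gr).
  by rewrite -(rotK i f') fE sumn_rotr_edges 2!map_cons 2!sumn_cons addnA.
have ltj : j < size g by rewrite (eqP szg).
have rg : rot j g = Node T.1 :: F by rewrite rotrK.
have cg : corner j [::] T.1 w T.2 \in contour g.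
  by have [m gr] := exg; exact: corner_contour ltj rg gr.
exists (@ForestCI n p (@Forest n p (Tuple szg) edg) _ (Ordinal lti') cg).
by have [m gr] := exg; exists T.1, F, T1, T2, w, T.2, m.
Qed.

Section Psi.

Variables (n p : nat) (x : forest_ci n p) (y : forest_vi n p).
Hypothesis p0 : 0 < p.
Hypothesis xy : grafted x y.

Let szx : size (trees x) = p. Proof. by rewrite size_tuple. Qed.
Let szy : size (trees y) = p.+1. Proof. by rewrite size_tuple. Qed.

Lemma grafted_psi_up : psi_up x y.
Proof.
have [ts [F [T1 [T2 [w [k [m [gr xE yE cE vE]]]]]]]] := xy.
have ltj : vi_index y < size (trees x) by rewrite szx.
have lti : ci_index x < size (trees y) by rewrite szy.
have lt1 : 1 < size (trees y) by rewrite szy.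
have [s1 [s2 [es [sz rep]]]] := map_up_represents ltj xE gr.
have rep' := represents_forest_map (ci_index x) (trees y); rewrite yE in rep'.
have [phi [iso phis]] := represents_iso (Extra 0 true) rep rep'.
have [t1 [t2 [tE szt]]] := rcontour_vertex lti lt1 yE gr.
rewrite /psi_up cE corner_org; exists (upward (vi_index y) [::] w), phi; split=> //=.
- apply: upward_self_avoiding.
  by rewrite /is_vertex ltj (rot_nth _ ltj xE) (graft_source_vertex gr).
- by rewrite (map_split _ (etrans phis tE)) ?sz ?szt // close_org vE.
- by rewrite vE.
Qed.

Lemma grafted_psi_down : psi_down y x.
Proof.
have [ts [F [T1 [T2 [w [k [m [gr xE yE cE vE]]]]]]]] := xy.
have ltj : vi_index y < size (trees x) by rewrite szx.
have lti : ci_index x < size (trees y) by rewrite szy.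
have lt1 : 1 < size (trees y) by rewrite szy.
have [h [q hq]] : exists h q, h :: q = rcons (upward (ci_index x) [::] w) (Extra (ci_index x) true).
  by case: (upward _ _ _) => [|h q]; do 2!eexists.
have [s1 [s2 [es [sz rep]]]] := map_down_represents lti lt1 yE gr hq.
have rep' := represents_forest_map (vi_index y) (trees x); rewrite xE in rep'.
have [phi [iso phis]] := represents_iso (Extra 0 true) rep rep'.
have [t1 [t2 [tE szt]]] := rcontour_corner ltj xE gr.
rewrite /psi_down vE; exists h, q, phi; split=> //=.
- have vy : is_vertex (trees y) (nat_of_ord (ci_index x), w).
    by rewrite -vE; case: (y).
  have := upward_next_self_avoiding vy; rewrite -hq szy; apply.
  exact: next_tree_neq.
- by rewrite (map_split _ (etrans phis tE)) ?sz ?szt.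
- by rewrite cE corner_org.
Qed.

(** Any outcome [y'] of the surgery represents the grafted forest, hence is a re-rooting of
    [y]; since the vertices of [y] and [y'] are both in the tree of index [ci_index x], the
    re-rooting is trivial. *)
Lemma psi_up_unique y' : psi_up x y' -> y' = y.
Proof.
have [ts [F [T1 [T2 [w [k [m [gr xE yE cE vE]]]]]]]] := xy.
have ltj : vi_index y < size (trees x) by rewrite szx.
move=> [q [phi []]]; rewrite cE corner_org /= => /upward_unique -> iso ev ei ej.
have [s1 [s2 [es [sz rep]]]] := map_up_represents ltj xE gr.
have szy' : size (trees y') = p.+1 by rewrite size_tuple.
have [|r ltr [rE rs]] := represents_rigid _ (represents_transport iso rep).
  by rewrite szy'.
have lt1 : 1 < size (trees y') by rewrite szy'.
have [t1 [t2 [tE szt]]] := rcontour_vertex ltr lt1 (esym rE) gr.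
have phi_stub := map_split (etrans sz (esym szt)) (etrans rs tE).
have {}ev : vi_vertex y' = (r, w) by rewrite -ev phi_stub close_org.
have {}ei : r = ci_index x by rewrite -ei ev.
apply: forest_vi_inj => //; last by rewrite ev vE ei.
by apply: (@rot_inj r); rewrite -rE ei yE.
Qed.

(** Similarly, the re-rooting is fixed by the index of the tree containing the corner. *)
Lemma psi_down_unique x' : psi_down y x' -> x' = x.
Proof.
have [ts [F [T1 [T2 [w [k [m [gr xE yE cE vE]]]]]]]] := xy.
have lti : ci_index x < size (trees y) by rewrite szy.
have lt1 : 1 < size (trees y) by rewrite szy.
have nx : next_tree (size (trees y)) (ci_index x) != ci_index x.
  by rewrite szy next_tree_neq.
move=> [h [q [phi []]]]; rewrite vE /= -[in X in next_tree X _]szy.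
move=> /(upward_next_unique nx) hq iso ec ej ei.
have [s1 [s2 [es [sz rep]]]] := map_down_represents lti lt1 yE gr hq.
have szx' : size (trees x') = p by rewrite size_tuple.
have [|r ltr [rE rs]] := represents_rigid _ (represents_transport iso rep).
  by rewrite szx'.
have [t1 [t2 [tE szt]]] := rcontour_corner ltr (esym rE) gr.
have := map_split (etrans sz (esym szt)) (etrans rs tE); rewrite ec => {}ec.
have {}ej : r = vi_index y by rewrite -ej ec corner_org.
apply: forest_ci_inj => //; last by rewrite ec cE ej.
by apply: (@rot_inj r); rewrite -rE ej xE.
Qed.

End Psi.

Theorem theorem2 (n p : nat) (hp : 1 <= p) :
  exists (Psi_up : forest_ci n p -> forest_vi n p)
         (Psi_down : forest_vi n p -> forest_ci n p),
    [/\ forall x y, psi_up x y <-> y = Psi_up x,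
        forall y x, psi_down y x <-> x = Psi_down y,
        bijective Psi_up /\ bijective Psi_down,
        cancel Psi_up Psi_down &
        cancel Psi_down Psi_up].
Proof.
pose up (x : forest_ci n p) := sval (grafted_up x).
pose down (y : forest_vi n p) := sval (grafted_down y hp).
have upP x : grafted x (up x) by exact: (svalP (grafted_up x)).
have downP y : grafted (down y) y by exact: (svalP (grafted_down y hp)).
have upK : cancel up down.
  by move=> x; apply: (psi_down_unique hp (upP x)); exact: (grafted_psi_down hp (downP _)).
have downK : cancel down up.
  by move=> y; apply: (psi_up_unique hp (downP y)); exact: (grafted_psi_up hp (upP _)).
exists up, down; split=> //.
- move=> x y; split=> [|->]; first exact: (psi_up_unique hp (upP x)).
  exact: (grafted_psi_up hp (upP _)).
- move=> y x; split=> [|->]; first exact: (psi_down_unique hp (downP y)).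
  exact: (grafted_psi_down hp (downP _)).
- by split; [exists down | exists up].
Qed.
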